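(* For the weight function $w_{\frac12}$ on $\Delta^*$ a Gaussian cubature formula exists; that is, for every integer $n\ge1$ and every polynomial $f\in\Pi_{2n-1}^2$, $$c_{\frac12}\int_{\Delta^*}f(x,y)\,w_{\frac12}(x,y)\,dx\,dy=\sum_{j_1=1}^{n+1}\ \sum_{j_2=1}^{n+1-j_1}\mu_{j}^{(n)}\,f\big(\tfrac{j_1}{n+2},\tfrac{j_2}{n+2}\big),$$ where $j=(j_1,j_2)$, $f(\tfrac{j_1}{n+2},\tfrac{j_2}{n+2})$ denotes the value of $f$ at the point $(x,y)\in\Delta^*$ corresponding to $(t_1,t_2)=(\tfrac{j_1}{n+2},\tfrac{j_2}{n+2})$ under the map $(t_1,t_2)\mapsto(x,y)$ of the context, and $$\mu_j^{(n)}=\frac{32}{9(n+2)^2}\,\sin^2\frac{\pi j_1}{n+2}\,\sin^2\frac{\pi j_2}{n+2}\,\sin^2\frac{\pi(j_1+j_2)}{n+2}.$$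
   Context: For $\mathbf t=(t_1,t_2,t_3)$ with $t_1+t_2+t_3=0$ put $x+iy=z(\mathbf t)=\frac13\big[e^{\frac{2\pi i}{3}(t_2-t_3)}+e^{\frac{2\pi i}{3}(t_1-t_2)}+e^{\frac{2\pi i}{3}(t_3-t_1)}\big]$, $x,y$ real. With $t_3=-t_1-t_2$, the map $(t_1,t_2)\mapsto(x,y)$ carries the triangle $\Delta=\{(t_1,t_2):t_1,t_2\ge0,t_1+t_2\le1\}$ onto the region bounded by Steiner's hypocycloid $\Delta^*=\{(x,y)\in\mathbb R^2:-3(x^2+y^2+1)^2+8(x^3-3xy^2)+4\ge0\}$. The weight is the Jacobian of this map, $w_{\frac12}(x,y)=\big|\frac{\partial(x,y)}{\partial(t_1,t_2)}\big|=\frac{16}{27}\pi^2\sin\pi t_1\sin\pi t_2\sin\pi(t_1+t_2)=\frac{2\pi^2}{3\sqrt3}\big[-3(x^2+y^2+1)^2+8(x^3-3xy^2)+4\big]^{1/2}$, and $c_{\frac12}=\frac{81}{8\pi^4}$. $\Pi_m^2$ is the space of polynomials in $(x,y)$ of total degree at most $m$. A cubature formula $\int f w=\sum_{k=1}^{K}\lambda_kf(x_k,y_k)$ exact for all $f\in\Pi_{2n-1}^2$ is called Gaussian if its number of nodes is $K=\dim\Pi_{n-1}^2=n(n+1)/2$, the minimal possible. *)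

(* Defs.v *)
From HB Require Import structures.
From mathcomp Require Import all_boot all_order all_algebra.
From mathcomp Require Import all_classical all_reals all_analysis.
From mathcomp Require Import complex ring lra.
(* Notations of mpoly clash with those of the analysis library; the type
   {mpoly R[n]} is therefore written [mpoly n R] and p.@[v] is [meval v p]. *)
From mathcomp Require Import -(notations) mpoly.

Set Implicit Arguments.
Unset Strict Implicit.
Unset Printing Implicit Defensive.

Import Order.TTheory GRing.Theory Num.Theory.
Import numFieldNormedType.Exports.

Local Open Scope classical_set_scope.
Local Open Scope ring_scope.

Section Cubature.
Context {R : realType}.

(* [msize f] is the total degree of f plus one, and 0 for f = 0. *)
Definition Pi2 (m : nat) : set (mpoly 2 R) := [set f | (msize f <= m.+1)%N].

Definition evalxy (f : mpoly 2 R) (p : R * R) : R :=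
  meval (tnth [tuple p.1; p.2]) f.

Definition has_dim (V : set (mpoly 2 R)) (d : nat) : Prop :=
  exists b : 'I_d -> mpoly 2 R,
    [/\ forall i, V (b i),
        forall a : 'I_d -> R, \sum_i a i *: b i = 0 -> forall i, a i = 0
      & forall f, V f -> exists a : 'I_d -> R, f = \sum_i a i *: b i].

Definition lebesgue2 := (@lebesgue_measure R \x @lebesgue_measure R)%E.

(* A cubature formula is the list of its pairs (lambda_k, (x_k, y_k)).  The
   integral is the extended-real one, so that exactness includes finiteness. *)
Definition exact_cubature (D : set (R * R)) (w : R * R -> R)
    (Q : seq (R * (R * R))) (m : nat) : Prop :=
  forall f : mpoly 2 R, Pi2 m f ->
    (\int[lebesgue2]_(p in D) (evalxy f p * w p)%:E =
     (\sum_(q <- Q) q.1 * evalxy f q.2)%:E)%E.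

(* For n >= 1. The nodes are required to be pairwise distinct, so that
   [size Q] is the number of nodes. *)
Definition gaussian_cubature (D : set (R * R)) (w : R * R -> R)
    (n : nat) (Q : seq (R * (R * R))) : Prop :=
  [/\ uniq [seq q.2 | q <- Q],
      has_dim (Pi2 n.-1) (size Q)
    & exact_cubature D w Q (2 * n).-1].

End Cubature.

Section Hypocycloid.
Context {R : realType}.
Implicit Types (t p : R * R).

Definition expi (a : R) : R[i] := (cos a +i* sin a)%C.

Definition zmap (t1 t2 t3 : R) : R[i] :=
  3^-1 * (expi (2 * pi / 3 * (t2 - t3)) + expi (2 * pi / 3 * (t1 - t2))
          + expi (2 * pi / 3 * (t3 - t1))).

Definition steiner_map t : R * R :=
  let z := zmap t.1 t.2 (- t.1 - t.2) in (complex.Re z, complex.Im z).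

Definition triangle : set (R * R) :=
  [set t | [/\ 0 <= t.1, 0 <= t.2 & t.1 + t.2 <= 1]].

Definition steiner_poly p : R :=
  - 3 * (p.1 ^+ 2 + p.2 ^+ 2 + 1) ^+ 2 + 8 * (p.1 ^+ 3 - 3 * p.1 * p.2 ^+ 2) + 4.

Definition hypocycloid : set (R * R) := [set p | 0 <= steiner_poly p].

(* As a function of (x, y); [w_half_jacobian] below identifies it with the
   absolute value of the Jacobian determinant of [steiner_map]. *)
Definition w_half p : R :=
  2 * pi ^+ 2 / (3 * Num.sqrt 3) * Num.sqrt (steiner_poly p).

Definition c_half : R := 81 / (8 * pi ^+ 4).

Definition node (n j1 j2 : nat) : R * R :=
  steiner_map (j1%:R / n.+2%:R, j2%:R / n.+2%:R).

Definition mu (n j1 j2 : nat) : R :=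
  32 / (9 * n.+2%:R ^+ 2) * sin (pi * j1%:R / n.+2%:R) ^+ 2
  * sin (pi * j2%:R / n.+2%:R) ^+ 2 * sin (pi * (j1 + j2)%:R / n.+2%:R) ^+ 2.

(* The factor [c_half^-1] appears because a cubature formula is stated for the
   integral against the weight itself, without normalization. *)
Definition gauss_rule (n : nat) : seq (R * (R * R)) :=
  [seq (c_half^-1 * mu n j1 j2, node n j1 j2)
     | j1 <- index_iota 1 n.+2, j2 <- index_iota 1 (n.+2 - j1)].

Definition jacobian t : R :=
  let X s1 s2 := (steiner_map (s1, s2)).1 in
  let Y s1 s2 := (steiner_map (s1, s2)).2 in
  derive1 (X^~ t.2) t.1 * derive1 (Y t.1) t.2
  - derive1 (X t.1) t.2 * derive1 (Y^~ t.2) t.1.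

Definition sin_prod t : R := sin (pi * t.1) * sin (pi * t.2) * sin (pi * (t.1 + t.2)).

Lemma steiner_mapE t : steiner_map t =
  (3^-1 * (cos (2 * pi / 3 * (t.1 + 2 * t.2)) + cos (2 * pi / 3 * (t.1 - t.2))
           + cos (2 * pi / 3 * (- 2 * t.1 - t.2))),
   3^-1 * (sin (2 * pi / 3 * (t.1 + 2 * t.2)) + sin (2 * pi / 3 * (t.1 - t.2))
           + sin (2 * pi / 3 * (- 2 * t.1 - t.2)))).
Proof.
rewrite /steiner_map /zmap /expi.
have -> : (3^-1 : R[i]) = (3^-1 +i* 0)%C.
  apply: (@mulfI _ (3 : R[i])); first by rewrite pnatr_eq0.
  rewrite mulfV ?pnatr_eq0 //.
  have -> : (3 : R[i]) = (3 +i* 0)%C by rewrite -[LHS](rmorph_nat (real_complex R)).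
  by rewrite /GRing.mul /=; congr Complex; field.
have -> : t.2 - (- t.1 - t.2) = t.1 + 2 * t.2 by ring.
have -> : - t.1 - t.2 - t.1 = - 2 * t.1 - t.2 by ring.
by congr (_, _) => /=; ring.
Qed.

Lemma sin_prodE t : 4 * sin_prod t =
  sin (2 * pi * t.1) + sin (2 * pi * t.2) - sin (2 * pi * (t.1 + t.2)).
Proof.
rewrite /sin_prod.
have -> : 2 * pi * t.1 = pi * t.1 + pi * t.1 :> R by ring.
have -> : 2 * pi * t.2 = pi * t.2 + pi * t.2 :> R by ring.
have -> : 2 * pi * (t.1 + t.2) = (pi * t.1 + pi * t.2) + (pi * t.1 + pi * t.2) :> R
  by ring.
have -> : pi * (t.1 + t.2) = pi * t.1 + pi * t.2 :> R by ring.
rewrite !(sinD, cosD).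
have := sin2cos2 (pi * t.1 : R); have := sin2cos2 (pi * t.2 : R).
set s2 := sin (pi * t.2); set c2 := cos (pi * t.2).
set s1 := sin (pi * t.1); set c1 := cos (pi * t.1) => h2 h1.
ring: h1 h2.
Qed.

Lemma steiner_poly_map t : steiner_poly (steiner_map t) = 64 / 27 * sin_prod t ^+ 2.
Proof.
suff h : steiner_poly (steiner_map t) = 4 / 27 * (4 * sin_prod t) ^+ 2.
  by rewrite h; field.
rewrite sin_prodE steiner_mapE /steiner_poly /=.
set u : R := 2 * pi / 3 * (t.1 + 2 * t.2); set v : R := 2 * pi / 3 * (t.1 - t.2).
have -> : 2 * pi / 3 * (- 2 * t.1 - t.2) = - (u + v) by rewrite /u /v; field.
have -> : 2 * pi * t.1 = u + (v + v) by rewrite /u /v; field.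
have -> : 2 * pi * t.2 = u - v by rewrite /u /v; field.
have -> : 2 * pi * (t.1 + t.2) = (u + u) + v by rewrite /u /v; field.
rewrite !(cosN, sinN, sinD, cosD).
have := sin2cos2 u; have := sin2cos2 v.
set s2 := sin v; set c2 := cos v; set s1 := sin u; set c1 := cos u => h2 h1.
by field: h1 h2.
Qed.

Lemma steiner_map_hypocycloid t : hypocycloid (steiner_map t).
Proof. by rewrite /hypocycloid /= steiner_poly_map mulr_ge0 ?sqr_ge0. Qed.

Lemma sin_prod_ge0 t : triangle t -> 0 <= sin_prod t.
Proof.
move=> [t1 t2 t12]; have p0 := pi_ge0 R.
have h (a : R) : 0 <= a -> a <= 1 -> 0 <= sin (pi * a).
  by move=> a0 a1; rewrite sin_ge0_pi // mulr_ge0 //= ler_piMr.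
by rewrite /sin_prod !mulr_ge0 // h //; lra.
Qed.

Lemma w_half_map t : triangle t ->
  w_half (steiner_map t) = 16 / 27 * pi ^+ 2
    * sin (pi * t.1) * sin (pi * t.2) * sin (pi * (t.1 + t.2)).
Proof.
move=> tD; rewrite /w_half steiner_poly_map.
have s3 : Num.sqrt 3 ^+ 2 = 3 :> R by rewrite sqr_sqrtr.
have s30 : Num.sqrt 3 != 0 :> R by rewrite sqrtr_eq0 -ltNge.
have -> : 64 / 27 * sin_prod t ^+ 2 = (8 / 9 * Num.sqrt 3 * sin_prod t) ^+ 2.
  by rewrite !exprMn s3; field.
rewrite sqrtr_sqr ger0_norm; last first.
  apply: mulr_ge0 (sin_prod_ge0 tD); by rewrite mulr_ge0 ?sqrtr_ge0.
by rewrite /sin_prod; field.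
Qed.

Lemma is_derive_aff (f : R -> R) (a b s d : R) : is_derive (a * s + b) 1 f d ->
  is_derive s 1 (fun s => f (a * s + b)) (d * a).
Proof.
move=> fd; have ga : is_derive s 1 (fun s => a * s + b) a.
  by apply: is_derive_eq; rewrite addr0 /GRing.scale /= mulr1.
exact: (@is_derive1_comp _ f (fun s => a * s + b)).
Qed.

Lemma derive1_aff3 (f f' g : R -> R) (a1 b1 a2 b2 a3 b3 s : R) :
  (forall x : R, is_derive x 1 f (f' x)) ->
  g = (fun s => 3^-1 * (f (a1 * s + b1) + f (a2 * s + b2) + f (a3 * s + b3))) ->
  derive1 g s = 3^-1 * (f' (a1 * s + b1) * a1 + f' (a2 * s + b2) * a2
                    + f' (a3 * s + b3) * a3).
Proof.
move=> fd ->; rewrite derive1E.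
have h1 := is_derive_aff (fd (a1 * s + b1)).
have h2 := is_derive_aff (fd (a2 * s + b2)).
have h3 := is_derive_aff (fd (a3 * s + b3)).
exact: (@derive_val _ _ _ _ _ _ _ (is_deriveZ 3^-1 (is_deriveD (is_deriveD h1 h2) h3))).
Qed.

Lemma jacobianE t : jacobian t = 16 / 27 * pi ^+ 2
  * sin (pi * t.1) * sin (pi * t.2) * sin (pi * (t.1 + t.2)).
Proof.
suff -> : jacobian t = 4 / 27 * pi ^+ 2 * (4 * sin_prod t) by rewrite /sin_prod; field.
set k : R := 2 * pi / 3.
have dc (x : R) : is_derive x 1 (@cos R) (- sin x) by exact: is_derive_cos.
have ds (x : R) : is_derive x 1 (@sin R) (cos x) by exact: is_derive_sin.
rewrite /jacobian.
rewrite (@derive1_aff3 cos (fun x => - sin x) _ k (k * 2 * t.2) k (- k * t.2)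
           (- 2 * k) (- k * t.2)) //; last first.
  by apply/funext => s; rewrite steiner_mapE /= -/k; congr (_ * (_ + _ + _));
     congr cos; ring.
rewrite (@derive1_aff3 sin cos _ (2 * k) (k * t.1) (- k) (k * t.1)
           (- k) (- 2 * k * t.1)) //; last first.
  by apply/funext => s; rewrite steiner_mapE /= -/k; congr (_ * (_ + _ + _));
     congr sin; ring.
rewrite (@derive1_aff3 cos (fun x => - sin x) _ (2 * k) (k * t.1) (- k) (k * t.1)
           (- k) (- 2 * k * t.1)) //; last first.
  by apply/funext => s; rewrite steiner_mapE /= -/k; congr (_ * (_ + _ + _));
     congr cos; ring.
rewrite (@derive1_aff3 sin cos _ k (k * 2 * t.2) k (- k * t.2)
           (- 2 * k) (- k * t.2)) //; last first.
  by apply/funext => s; rewrite steiner_mapE /= -/k; congr (_ * (_ + _ + _));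
     congr sin; ring.
rewrite sin_prodE.
set u : R := k * (t.1 + 2 * t.2); set v : R := k * (t.1 - t.2).
have -> : k * t.1 + k * 2 * t.2 = u by rewrite /u; ring.
have -> : 2 * k * t.2 + k * t.1 = u by rewrite /u; ring.
have -> : k * t.1 + - k * t.2 = v by rewrite /v; ring.
have -> : - k * t.2 + k * t.1 = v by rewrite /v; ring.
have -> : - 2 * k * t.1 + - k * t.2 = - (u + v) by rewrite /u /v; ring.
have -> : - k * t.2 + - 2 * k * t.1 = - (u + v) by rewrite /u /v; ring.
have -> : 2 * pi * t.1 = u + (v + v) by rewrite /u /v /k; field.
have -> : 2 * pi * t.2 = u - v by rewrite /u /v /k; field.
have -> : 2 * pi * (t.1 + t.2) = (u + u) + v by rewrite /u /v /k; field.
rewrite !(cosN, sinN, sinD, cosD).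
have := sin2cos2 u; have := sin2cos2 v.
set s2 := sin v; set c2 := cos v; set s1 := sin u; set c1 := cos u => h2 h1.
by rewrite /k; field: h1 h2.
Qed.

Lemma w_half_jacobian t : triangle t -> w_half (steiner_map t) = `|jacobian t|.
Proof.
move=> tD; rewrite jacobianE -w_half_map // ger0_norm // /w_half.
apply: mulr_ge0; last exact: sqrtr_ge0.
apply: divr_ge0; apply: mulr_ge0 => //; exact: sqr_ge0.
Qed.

End Hypocycloid.

(* Main.v *)
Require Import Defs.
From mathcomp Require Import all_boot all_order all_algebra.
From mathcomp Require Import all_classical all_reals all_analysis.
From mathcomp Require Import complex ring lra zify.
From mathcomp Require Import -(notations) mpoly.
Import Order.TTheory GRing.Theory Num.Theory.
Import numFieldNormedType.Exports measurable_realfun.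
Local Open Scope classical_set_scope.
Local Open Scope ring_scope.

(** Write u1, u2, u3 for three unimodular complex numbers of product 1, with
    arguments a, b and - (a + b).  The map t |-> z(t) sends t to the mean of
    the u_k, so polynomials of degree d in (x, y) become trigonometric
    polynomials in (a, b) whose frequencies lie in a hexagon of radius d
    ([trigpoly_evalxy]), and [steiner_poly] becomes, up to a factor, the square
    of [torus_den], the Weyl denominator of SU(3).  The theorem amounts to two
    facts about f * torus_den ^ 2.

    First, the integral of f against the weight is, up to a constant, the mean
    of f * torus_den ^ 2 over the torus ([integral_hypocycloid_torus]).  Instead
    of a two-dimensional change of variables, the proof uses the tangent lines
    of the hypocycloid: freezing u2 at angle 2 phi and letting u1 and u3 vary
    moves z along a chord of direction - phi, which lies on a tangent line, and
    every interior point lies on three such lines.  On a horizontal slice at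
    height y the abscissa of the point of the tangent line is monotone in phi on
    three consecutive intervals, each of which covers the slice once, so that
    the integral over phi of h(x(phi)) |x'(phi)| is three times that of h
    ([integral_tangent_cover]).  Exchanging the two integrations leaves, for
    each phi, an integral along a chord, which the substitution
    y = y(phi, beta) turns into an integral over beta, covering the chord twice
    ([integral_line_cover]).

    Second, the sum over the nodes is, up to a constant, the sum of
    f * torus_den ^ 2 over a full square grid of (3 N) ^ 2 points with N = n + 2
    ([grid_sum_triangle]): the square is tiled by copies of the triangle of nodes under
    a reflection, which fixes z, and translations by N, which turn z by a third
    of a circle, and turning z only permutes the nodes; the edges of the tiles
    do not contribute because torus_den vanishes there.  An equidistant sum over
    this grid agrees with the mean over the torus for all frequencies in the
    hexagon of radius less than 2 N, apart from 0 no such frequency being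
    aliased to 0 ([grid_sum_torus]).  Here the radius is
    (2 n - 1) + 4 = 2 N - 1, so that f of degree 2 n - 1 is the limit of what
    the grid can resolve.

    That the rule is Gaussian is then a count: the nodes are distinct because
    z determines the elementary symmetric functions of the u_k, hence the
    u_k up to order ([node_inj]), and their indices match the monomials of
    degree less than n ([has_dim_Pi2]). *)

(** * Substitution on the line without injectivity *)

Lemma is_derive_continuous (R : realType) (f : R -> R) (x d : R) :
  is_derive x 1 f d -> {for x, continuous f}.
Proof.
move=> fd; apply/differentiable_continuous/derivable1_diffP.
exact: (@ex_derive _ _ _ _ _ _ _ fd).
Qed.

(** The last two clauses evaluate the primitive to the right and to the left of the
    support of h: the total integral of h is then a difference of two values
    of G, which is what a substitution computes. *)
Lemma exists_primitive (R : realType) (h : R -> R) :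
  continuous h -> (@lebesgue_measure R).-integrable setT (EFin \o h) ->
  exists G : R -> R, [/\ forall x : R, is_derive x 1 G (h x),
    forall r, (forall x, r < x -> h x = 0) ->
      (\int[@lebesgue_measure R]_x (h x)%:E = (G r)%:E)%E
    & forall l, (forall x, x <= l -> h x = 0) -> G l = 0].
Proof.
move=> ch ih.
have ihD (D : set (measurableTypeR R)) : measurable D ->
    (@lebesgue_measure R).-integrable D (EFin \o h).
  by move=> mD; apply: integrableS ih.
pose G x := \int[@lebesgue_measure R]_(t in `]-oo, x]) h t.
exists G; split.
- move=> x.
  have x1 : x < x + 1 by rewrite ltrDl.
  have ih1 : (@lebesgue_measure R).-integrable `]-oo, x + 1] (EFin \o h) by exact: ihD.
  have /(_ _ (ch x)) := @continuous_FTC1 R h -oo%O x (x + 1) x1 ih1.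
  case=> [|dG G']; first by rewrite ltNyr.
  by apply: DeriveDef; [exact: dG | rewrite -derive1E].
- move=> r hr.
  have -> : (G r)%:E = (\int[@lebesgue_measure R]_(t in `]-oo, r]) (h t)%:E)%E.
    rewrite /G /Rintegral fineK //; apply: integrable_fin_num => //; exact: ihD.
  rewrite [RHS]integral_mkcond; apply: eq_integral => x _.
  rewrite patchE; case: ifPn => // /negP xr; rewrite hr // ltNge.
  by apply/negP => xr'; apply: xr; rewrite inE /= in_itv.
- move=> l hl; rewrite /G /Rintegral integral0_eq // => x.
  by rewrite /= in_itv /= => /hl ->.
Qed.

(** By the chain rule alone, so u need not be monotone. *)
Lemma integral_comp_derive (R : realType) (G g u u' : R -> R) (a b : R) :
  a <= b -> continuous g -> (forall x : R, is_derive x 1 G (g x)) ->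
  (forall t : R, a <= t <= b -> is_derive t 1 u (u' t)) ->
  (forall t, a <= t <= b -> {for t, continuous u'}) ->
  (\int[@lebesgue_measure R]_(t in `[a, b]) (g (u t) * u' t)%:E
   = (G (u b) - G (u a))%:E)%E.
Proof.
rewrite le_eqVlt => /predU1P[<- *|ab cg dG du cu'].
  by rewrite set_itv1 integral_set1 subrr.
have dGu t : a <= t <= b -> is_derive t 1 (G \o u) (g (u t) * u' t).
  by move=> tab; have := du t tab => ?; have := dG (u t) => ?; exact: is_derive1_comp.
have cGu t : a <= t <= b -> {for t, continuous (G \o u)}.
  by move=> /dGu; exact: is_derive_continuous.
have cgu t : a <= t <= b -> {for t, continuous (fun t => g (u t) * u' t)}.
  move=> tab; apply: cvgM; last exact: cu'.
  apply: continuous_comp; last exact: cg.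
  exact: is_derive_continuous (du t tab).
rewrite (continuous_FTC2 (F := G \o u)) //.
- apply: continuous_in_subspaceT => t; rewrite inE /= in_itv /=; exact: cgu.
- split.
  + move=> t; rewrite in_itv /= => /andP[/ltW ta /ltW tb].
    have dt := dGu t (introT andP (conj ta tb)).
    exact: (@ex_derive _ _ _ _ _ _ _ dt).
  + apply: cvg_at_right_filter; apply: cGu; lra.
  + apply: cvg_at_left_filter; apply: cGu; lra.
- move=> t; rewrite in_itv /= => /andP[/ltW ta /ltW tb].
  have dt := dGu t (introT andP (conj ta tb)).
  by rewrite derive1E (@derive_val _ _ _ _ _ _ _ dt).
Qed.

(** One sheet of a covering: u runs once, in the direction given by the sign e,
    across an interval [l, r] that contains the support of h. *)
Lemma integral_subst_support (R : realType) (h u u' : R -> R) (a b l r e : R) :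
  continuous h -> (@lebesgue_measure R).-integrable setT (EFin \o h) ->
  (forall x, x <= l \/ r <= x -> h x = 0) ->
  a <= b ->
  (forall t : R, a <= t <= b -> is_derive t 1 u (u' t)) ->
  (forall t, a <= t <= b -> {for t, continuous u'}) ->
  (u a = l /\ u b = r /\ e = 1) \/ (u a = r /\ u b = l /\ e = -1) ->
  (forall t, a <= t <= b -> 0 <= e * u' t) ->
  (\int[@lebesgue_measure R]_(t in `[a, b]) (h (u t) * `|u' t|)%:E
   = \int[@lebesgue_measure R]_x (h x)%:E)%E.
Proof.
move=> ch ih h0 ab du cu' ends sgn.
have [G [dG Gr Gl]] := exists_primitive _ _ ch ih.
rewrite (Gr r); last by move=> x rx; apply: h0; right; exact: ltW.
have Gl0 : G l = 0 by apply: Gl => x xl; apply: h0; left.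
pose h' x := e * h x; pose G' x := e * G x.
have e1 : `|e| = 1 by case: ends => -[_ [_ ->]]; rewrite ?normrN normr1.
transitivity (\int[@lebesgue_measure R]_(t in `[a, b]) (h' (u t) * u' t)%:E)%E.
  apply: eq_integral => t; rewrite inE /= in_itv /= => /sgn; rewrite /h'.
  move=> s0; congr (_%:E); rewrite mulrAC mulrC; congr (_ * _).
  by rewrite -[LHS]mul1r -e1 -normrM ger0_norm.
have dG' (x : R) : is_derive x 1 G' (h' x).
  by have := dG x => ?; exact: is_deriveZ.
rewrite (integral_comp_derive _ G' h' u u') //; last first.
  by move=> x; apply: cvgM; [exact: cvg_cst | exact: ch].
congr (_%:E); rewrite /G'.
by case: ends => -[-> [-> ->]]; rewrite Gl0; ring.
Qed.

Lemma integral_itv_cat (R : realType) (f : R -> R) (a b c : R) :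
  a <= b <= c -> (forall t, a <= t <= c -> {for t, continuous f}) ->
  (\int[@lebesgue_measure R]_(t in `[a, c]) (f t)%:E =
   \int[@lebesgue_measure R]_(t in `[a, b]) (f t)%:E
   + \int[@lebesgue_measure R]_(t in `[b, c]) (f t)%:E)%E.
Proof.
move=> /andP[ab bc] cf.
have mf (i : interval R) : [set` i] `<=` `[a, c] ->
    measurable_fun [set` i] (EFin \o f).
  move=> iac; apply/measurable_EFinP.
  apply: (@measurable_funS _ _ _ _ `[a, c]) => //.
  apply: subspace_continuous_measurable_fun => //.
  by apply: continuous_in_subspaceT => t; rewrite inE /= in_itv; exact: cf.
have acE : `[a, c]%classic = `[a, b]%classic `|` `]b, c]%classic.
  apply/seteqP; split=> t /=; rewrite !in_itv /=; first by case: (leP t b) => ?; lra.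
  by case; lra.
rewrite acE integral_setU //; last 2 first.
- by rewrite -acE; exact: mf.
- apply/disj_setPS => t [] /=; rewrite !in_itv /=; lra.
congr (_ + _)%E; apply: integral_itv_obnd_cbnd.
by apply: mf => t /=; rewrite !in_itv /=; lra.
Qed.

(** A covering with one fold point b, traversed down and then up. *)
Lemma integral_fold2 (R : realType) (h u u' : R -> R) (a b c l r : R) :
  continuous h -> (@lebesgue_measure R).-integrable setT (EFin \o h) ->
  (forall x, x <= l \/ r <= x -> h x = 0) ->
  a <= b <= c ->
  (forall t : R, a <= t <= c -> is_derive t 1 u (u' t)) ->
  (forall t, a <= t <= c -> {for t, continuous u'}) ->
  u a = r -> u b = l -> u c = r ->
  (forall t, a <= t <= b -> u' t <= 0) -> (forall t, b <= t <= c -> 0 <= u' t) ->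
  (\int[@lebesgue_measure R]_(t in `[a, c]) (h (u t) * `|u' t|)%:E
   = 2%:E * \int[@lebesgue_measure R]_x (h x)%:E)%E.
Proof.
move=> ch ih h0 /andP[ab bc] du cu' ua ub uc s1 s2.
rewrite (integral_itv_cat _ _ a b c) ?ab ?bc //; last first.
  move=> t tac; apply: cvgM; last by apply: cvg_norm; exact: cu'.
  apply: continuous_comp; last exact: ch.
  exact: is_derive_continuous (du t tac).
have du1 (t : R) : a <= t <= b -> is_derive t 1 u (u' t) by move=> tab; apply: du; lra.
have cu1 t : a <= t <= b -> {for t, continuous u'} by move=> tab; apply: cu'; lra.
have du2 (t : R) : b <= t <= c -> is_derive t 1 u (u' t) by move=> tab; apply: du; lra.
have cu2 t : b <= t <= c -> {for t, continuous u'} by move=> tab; apply: cu'; lra.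
rewrite (@integral_subst_support _ h u u' a b l r (-1) ch ih h0 ab du1 cu1) //; first last.
- by move=> t /s1; lra.
- by right.
rewrite (@integral_subst_support _ h u u' b c l r 1 ch ih h0 bc du2 cu2) //; first last.
- by move=> t /s2; lra.
- by left.
by rewrite -mule2n mule_natl.
Qed.

(** A covering with two fold points b and c; the sign e tells whether the first
    sheet is increasing. *)
Lemma integral_fold3 (R : realType) (h u u' : R -> R) (a b c d l r e : R) :
  continuous h -> (@lebesgue_measure R).-integrable setT (EFin \o h) ->
  (forall x, x <= l \/ r <= x -> h x = 0) ->
  [/\ a <= b, b <= c & c <= d] ->
  (forall t : R, a <= t <= d -> is_derive t 1 u (u' t)) ->
  (forall t, a <= t <= d -> {for t, continuous u'}) ->
  [/\ u a = l, u b = r, u c = l, u d = r & e = 1] \/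
  [/\ u a = r, u b = l, u c = r, u d = l & e = -1] ->
  [/\ forall t, a <= t <= b -> 0 <= e * u' t,
      forall t, b <= t <= c -> e * u' t <= 0
    & forall t, c <= t <= d -> 0 <= e * u' t] ->
  (\int[@lebesgue_measure R]_(t in `[a, d]) (h (u t) * `|u' t|)%:E
   = 3%:E * \int[@lebesgue_measure R]_x (h x)%:E)%E.
Proof.
move=> ch ih h0 [ab bc cd] du cu' ends [s1 s2 s3].
have chu t : a <= t <= d -> {for t, continuous (fun t => h (u t) * `|u' t|)}.
  move=> tac; apply: cvgM; last by apply: cvg_norm; exact: cu'.
  apply: continuous_comp; last exact: ch.
  exact: is_derive_continuous (du t tac).
have duI x y : a <= x -> y <= d -> forall t : R, x <= t <= y -> is_derive t 1 u (u' t).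
  by move=> ax yd t txy; apply: du; lra.
have cuI x y : a <= x -> y <= d -> forall t, x <= t <= y -> {for t, continuous u'}.
  by move=> ax yd t txy; apply: cu'; lra.
rewrite (integral_itv_cat _ _ a b d) ?ab ?(le_trans bc) //.
rewrite (integral_itv_cat _ _ b c d) ?bc ?cd //; last by move=> t tbd; apply: chu; lra.
have ac : a <= c by apply: le_trans bc.
have bd : b <= d by apply: le_trans cd.
have ad : a <= d by apply: le_trans bd.
have dux x y ax yd s xy := @integral_subst_support _ h u u' x y _ _ s ch ih h0 xy (duI x y ax yd) (cuI x y ax yd).
rewrite (dux a b (lexx a) bd e ab) //; last by case: ends => -[]; tauto.
rewrite (dux b c ab cd (- e) bc) //; first last.
- by move=> t /s2; lra.
- by case: ends => -[? ? ? ? ->]; rewrite ?opprK; tauto.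
rewrite (dux c d ac (lexx d) e cd) //; last by case: ends => -[]; tauto.
by rewrite mule_natl.
Qed.

(** * Tangent lines of the hypocycloid *)

Section Lines.
Context {R : realType}.
Implicit Types (phi y x : R).

(** The height at which the tangent line of parameter phi touches the
    hypocycloid: there the abscissa [line_x] is stationary in phi. *)
Definition kappa phi : R := 8 / 3 * sin phi ^+ 3 * cos phi.
(** The height of the upper end of the chord that the tangent line cuts out
    (cf. [line_y], whose values at 0 and pi are the two ends). *)
Definition eta phi : R := 2 / 3 * sin phi * (1 + cos phi).
(** The abscissa, at height y, of the tangent line of parameter phi. *)
Definition line_x phi y : R := (4 * cos phi ^+ 2 - 1) / 3 - y * (cos phi / sin phi).
Definition dline_x phi y : R := (y - kappa phi) / sin phi ^+ 2.

Lemma sqr_sinE phi : sin phi ^+ 2 = 1 - cos phi ^+ 2.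
Proof. by rewrite -(cos2Dsin2 phi) addrC addKr. Qed.

(** Along a tangent line the quartic [steiner_poly] has a double root at the
    contact point and two simple roots at the ends of the chord. *)
Lemma steiner_poly_line phi y : sin phi != 0 ->
  steiner_poly (line_x phi y, y) =
  4 / 3 * (y - kappa phi) ^+ 2 / sin phi ^+ 4
  * ((sin phi * (1 - cos phi) + 3 / 2 * y) * (sin phi * (1 + cos phi) - 3 / 2 * y)).
Proof.
move=> s0; rewrite /steiner_poly /line_x /kappa /=.
have := sqr_sinE phi; move: s0; set s := sin phi; set c := cos phi => s0 h.
by field: h.
Qed.

Lemma sin_ne0 phi : 0 < phi < pi -> sin phi != 0.
Proof. by move=> /sin_gt0_pi; rewrite lt0r => /andP[]. Qed.

Lemma steiner_poly_line_le0 phi y : 0 < phi < pi -> 0 < y -> eta phi <= y ->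
  steiner_poly (line_x phi y, y) <= 0.
Proof.
move=> phi0 y0 ey; rewrite steiner_poly_line ?sin_ne0 //.
have sp := sin_gt0_pi phi0; have := cos_le1 phi => c1.
apply: mulr_ge0_le0.
  apply: divr_ge0; last by rewrite exprn_ge0 // ltW.
  by apply: mulr_ge0; rewrite ?sqr_ge0.
apply: mulr_ge0_le0; last by move: ey; rewrite /eta; lra.
by apply: addr_ge0; apply: mulr_ge0; rewrite ?subr_ge0 ?(ltW sp) ?(ltW y0) //.
Qed.

Lemma is_derive_line_x phi y : 0 < phi < pi ->
  is_derive phi 1 (line_x^~ y) (dline_x phi y).
Proof.
move=> phi0; have s0 := sin_ne0 phi phi0.
have ds : is_derive phi 1 (fun t : R => (sin t)^-1) (- sin phi ^- 2 *: cos phi).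
  by have := is_derive_sin phi => ?; exact: is_deriveV.
rewrite /line_x.
have := is_derive_cos phi => dc.
apply: is_derive_eq.
rewrite /dline_x /kappa /GRing.scale /=.
have := sqr_sinE phi; move: s0; set s := sin phi; set c := cos phi => s0' h.
by field: h.
Qed.

Lemma continuous_line_x phi y : 0 < phi < pi -> {for phi, continuous (line_x^~ y)}.
Proof. by move=> /(is_derive_line_x _ y); exact: is_derive_continuous. Qed.

Lemma continuous_dline_x phi y : 0 < phi < pi -> {for phi, continuous (dline_x^~ y)}.
Proof.
move=> phi0; rewrite /dline_x /kappa.
have csn n : {for phi, continuous (fun t : R => sin t ^+ n)}.
  apply: (@continuous_comp _ _ _ sin (fun x : R => x ^+ n)); first exact: continuous_sin.
  exact: exprn_continuous.
have cc := @continuous_cos R phi.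
apply: cvgM.
  apply: cvgB; first exact: cvg_cst.
  apply: cvgM => //; apply: cvgM; first exact: cvg_cst.
  exact: csn.
apply: cvgV; first by rewrite expf_neq0 // sin_ne0.
exact: csn.
Qed.

(** The triple angle formula makes cos (pi / 3) a root of
    (c + 1) (2 c - 1) ^ 2. *)
Lemma cos_pi3 : cos (pi / 3) = 1 / 2 :> R.
Proof.
have p0 := pi_gt0 R.
have : cos (pi / 3 + (pi / 3 + pi / 3)) = -1 :> R by rewrite -cospi; congr cos; field.
rewrite !cosD !sinD.
have c0 : 0 < cos (pi / 3 : R) by apply: cos_gt0_pihalf; apply/andP; split; lra.
have := sqr_sinE (pi / 3); set s := sin _; set c := cos _ => h.
have -> : c * (c * c - s * s) - s * (s * c + c * s) = c ^+ 3 - 3 * c * s ^+ 2 by ring.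
rewrite h => h3.
have : (c + 1) * (2 * c - 1) ^+ 2 = 0.
  by apply: (eq_trans (y := c ^+ 3 - 3 * c * (1 - c ^+ 2) + 1)); [ring | rewrite h3 addNr].
move/eqP; rewrite mulf_eq0 sqrf_eq0; case/orP => /eqP; rewrite /c in c0 *; lra.
Qed.

Lemma is_derive_eta phi :
  is_derive phi 1 eta (2 / 3 * (2 * cos phi - 1) * (1 + cos phi)).
Proof.
have := is_derive_sin phi => ds; have := is_derive_cos phi => dc.
rewrite /eta; apply: is_derive_eq.
rewrite /GRing.scale /=.
have := sqr_sinE phi; set s := sin phi; set c := cos phi => h.
by ring: h.
Qed.

Lemma continuous_eta : continuous eta.
Proof. by move=> phi; exact: is_derive_continuous (is_derive_eta phi). Qed.

Lemma le_eta_incr (a b : R) : 0 <= a -> a <= b -> b <= pi / 3 -> eta a <= eta b.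
Proof.
move=> a0 ab bp; have p0 := pi_gt0 R.
apply: (@ger0_derive1_le_cc _ eta 0 (pi / 3)) => //.
- move=> x; rewrite in_itv /= => /andP[x0 xp].
  have := is_derive_eta x => dx; rewrite derive1E (@derive_val _ _ _ _ _ _ _ dx).
  have : cos (pi / 3 : R) < cos x by rewrite ltr_cos // in_itv /=; lra.
  have := cos_geN1 x; rewrite cos_pi3 => c1 c2.
  by rewrite !mulr_ge0 //; lra.
- by apply: continuous_subspaceT => x; exact: continuous_eta.
- by rewrite in_itv /=; lra.
- by rewrite in_itv /=; lra.
Qed.

Lemma le_eta_decr (a b : R) : pi / 3 <= a -> a <= b -> b <= pi -> eta b <= eta a.
Proof.
move=> a0 ab bp; have p0 := pi_gt0 R.
apply: (@ler0_derive1_le_cc _ eta (pi / 3) pi) => //.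
- move=> x; rewrite in_itv /= => /andP[x0 xp].
  have := is_derive_eta x => dx; rewrite derive1E (@derive_val _ _ _ _ _ _ _ dx).
  have : cos x < cos (pi / 3 : R) by rewrite ltr_cos // in_itv /=; lra.
  have := cos_geN1 x; rewrite cos_pi3 => c1 c2.
  by apply: mulr_le0_ge0; lra.
- by apply: continuous_subspaceT => x; exact: continuous_eta.
- by rewrite in_itv /=; lra.
- by rewrite in_itv /=; lra.
Qed.

(** The contact point of the line of parameter phi is the upper end of the chord of
    the line of parameter pi - 2 phi: there two of the u_k have argument 2 phi,
    and the third one has argument - 4 phi, which is 2 (pi - 2 phi) up to 2 pi. *)
Lemma kappaE phi : kappa phi = eta (pi - 2 * phi).
Proof.
rewrite /kappa /eta.
have -> : pi - 2 * phi = (phi + phi) *- 1 + pi by rewrite mulr1n; ring.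
rewrite sinDpi cosDpi mulr1n sinN cosN sinD cosD.
have := sqr_sinE phi; set s := sin phi; set c := cos phi => h.
by ring: h.
Qed.

(** A boundary point lies on its own tangent and on the line that ends there. *)
Lemma line_x_double phi y : 0 < phi < pi / 2 -> kappa phi = y ->
  line_x (pi - 2 * phi) y = line_x phi y.
Proof.
move=> phi0 <-; have p0 := pi_gt0 R.
have s0 : sin phi != 0 by apply: sin_ne0; lra.
have c0 : cos phi != 0 by rewrite gt_eqF // cos_gt0_pihalf //; lra.
rewrite /kappa /line_x.
have -> : pi - 2 * phi = (phi + phi) *- 1 + pi by rewrite mulr1n; ring.
rewrite sinDpi cosDpi mulr1n sinN cosN sinD cosD.
have := sqr_sinE phi; move: s0 c0; set s := sin phi; set c := cos phi => s0 c0 h.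
have -> : s * c + c * s = 2 * (s * c) by ring.
by field: h; rewrite s0 c0.
Qed.

(** As phi tends to pi, - y cot phi tends to +oo; the intermediate value theorem is
    applied up to an explicit angle of cotangent - T with T large. *)
Lemma line_x_surj_ge (d x y : R) : 0 < d < pi -> 0 < y -> line_x d y <= x ->
  exists2 phi, d <= phi < pi & line_x phi y = x.
Proof.
move=> d0 y0 dx; have sd := sin_gt0_pi d0.
(* The first bound puts the angle to the right of d; the second one comes from
   4 cos ^ 2 - 1 >= -1. *)
pose T := Num.max (- (cos d / sin d)) ((x + 1 / 3) / y).
pose phi := pi / 2 + atan T.
have [aT1 aT2] : - (pi / 2) < atan T /\ atan T < pi / 2.
  by split; [exact: atan_gtNpi2 | exact: atan_ltpi2].
have phi0 : 0 < phi < pi by rewrite /phi; lra.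
have sE : sin phi = cos (atan T) by rewrite /phi addrC sinDpihalf.
have s0 := sin_gt0_pi phi0.
have cE : cos phi = - T * sin phi.
  rewrite /phi addrC cosDpihalf sinDpihalf mulNr -[X in X * _](atanK T) /tan.
  by rewrite divfK // -sE gt_eqF.
have dphi : d <= phi.
  rewrite leNgt; apply/negP => phid.
  have : 0 < sin (d - phi) by apply: sin_gt0_pi; lra.
  rewrite sinB cE => hs.
  have : - (cos d / sin d) <= T by rewrite /T le_max lexx.
  rewrite -mulNr ler_pdivrMr // => hT.
  have : 0 <= sin phi * (T * sin d + cos d) by apply: mulr_ge0; lra.
  by lra.
have phix : x <= line_x phi y.
  rewrite /line_x cE mulfK ?gt_eqF //.
  have : (x + 1 / 3) / y <= T by rewrite /T le_max lexx orbT.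
  rewrite ler_pdivrMr // => hT.
  by have := sqr_ge0 (- T * sin phi); lra.
have := @IVT R (line_x^~ y) d phi x dphi.
case.
- apply: continuous_in_subspaceT => t; rewrite inE /= in_itv /= => tdp.
  by apply: continuous_line_x; lra.
- by rewrite ge_min dx le_max phix orbT.
- by move=> t; rewrite in_itv /= => tdp tx; exists t => //; lra.
Qed.

(** The mirror statement, with phi tending to 0. *)
Lemma line_x_surj_le (a x y : R) : 0 < a < pi -> 0 < y -> x <= line_x a y ->
  exists2 phi, 0 < phi <= a & line_x phi y = x.
Proof.
move=> a0 y0 ax; have sa := sin_gt0_pi a0.
pose T := Num.max (cos a / sin a) ((1 - x) / y).
pose phi := pi / 2 - atan T.
have [aT1 aT2] : - (pi / 2) < atan T /\ atan T < pi / 2.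
  by split; [exact: atan_gtNpi2 | exact: atan_ltpi2].
have phi0 : 0 < phi < pi by rewrite /phi; lra.
have sE : sin phi = cos (atan T) by rewrite /phi addrC sinDpihalf cosN.
have s0 := sin_gt0_pi phi0.
have cE : cos phi = T * sin phi.
  rewrite /phi addrC cosDpihalf sinDpihalf sinN cosN opprK -[X in X * _](atanK T) /tan.
  by rewrite divfK // -sE gt_eqF.
have dphi : phi <= a.
  rewrite leNgt; apply/negP => phid.
  have : 0 < sin (phi - a) by apply: sin_gt0_pi; lra.
  rewrite sinB cE => hs.
  have : (cos a / sin a) <= T by rewrite /T le_max lexx.
  rewrite ler_pdivrMr // => hT.
  have : 0 <= sin phi * (T * sin a - cos a) by apply: mulr_ge0; lra.
  by lra.
have phix : line_x phi y <= x.
  rewrite /line_x {2}cE mulfK ?gt_eqF //.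
  have : (1 - x) / y <= T by rewrite /T le_max lexx orbT.
  rewrite ler_pdivrMr // => hT.
  have := sqr_sinE phi; have := sqr_ge0 (sin phi); lra.
have := @IVT R (line_x^~ y) phi a x dphi.
case.
- apply: continuous_in_subspaceT => t; rewrite inE /= in_itv /= => tdp.
  by apply: continuous_line_x; lra.
- by rewrite ge_min phix le_max ax orbT.
- by move=> t; rewrite in_itv /= => tdp tx; exists t => //; lra.
Qed.

(** The height eta (pi / 3) is that of the upper cusp: above it every point lies on
    a tangent line outside of its chord. *)
Lemma steiner_poly_high x y : eta (pi / 3) <= y -> steiner_poly (x, y) <= 0.
Proof.
move=> ey; have p0 := pi_gt0 R.
have y0 : 0 < y.
  apply: lt_le_trans ey; rewrite /eta cos_pi3.
  by rewrite !mulr_gt0 // ?sin_gt0_pi //; lra.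
have etay phi : 0 < phi < pi -> eta phi <= y.
  move=> phi0; apply: le_trans ey.
  by case: (leP phi (pi / 3)) => ?; [apply: le_eta_incr | apply: le_eta_decr]; lra.
have p2 : 0 < (pi / 2 : R) < pi by lra.
have [xm|xm] := leP x (line_x (pi / 2) y).
  have [phi phi0 <-] := line_x_surj_le _ _ _ p2 y0 xm.
  by apply: steiner_poly_line_le0 => //; [|apply: etay]; lra.
have [phi phi0 <-] := line_x_surj_ge _ _ _ p2 y0 (ltW xm).
by apply: steiner_poly_line_le0 => //; [|apply: etay]; lra.
Qed.

Lemma steiner_polyN x y : steiner_poly (x, - y) = steiner_poly (x, y) :> R.
Proof. by rewrite /steiner_poly /=; ring. Qed.

(** A contact point lies strictly below the upper end of its chord, except at the
    cusp where they coincide: the difference contains (2 cos phi - 1) ^ 2. *)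
Lemma kappa_lt_eta phi : 0 < phi < pi -> phi != pi / 3 -> kappa phi < eta phi.
Proof.
move=> phi0 phip; have p0 := pi_gt0 R; have s0 := sin_gt0_pi phi0.
have c1 : -1 < cos phi.
  by rewrite -cospi ltr_cos ?in_itv /=; lra.
have ch : 2 * cos phi - 1 != 0.
  apply: contra phip => /eqP ch; apply/eqP/cos_inj; rewrite ?in_itv /=; try lra.
  by rewrite cos_pi3; lra.
have -> : kappa phi = eta phi - 2 / 3 * sin phi * ((1 + cos phi) * (2 * cos phi - 1) ^+ 2).
  rewrite /kappa /eta.
  have := sqr_sinE phi; set s := sin phi; set c := cos phi => h.
  by field: h.
rewrite ltrBlDr ltrDl; apply: mulr_gt0; first by apply: mulr_gt0 => //; lra.
by apply: mulr_gt0; [lra | rewrite lt0r sqr_ge0 sqrf_eq0 ch].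
Qed.

(** The three sheets over the slice at height y.  The slice is the interval [l, r];
    the fold points b and c are the parameters of the tangents at its ends,
    and a and d those of the lines that end there.  Outside of [a, d] the point
    at height y is off the chord. *)
Lemma slice_points y : 0 < y < eta (pi / 3) ->
  exists a b c d l r : R,
  [/\ 0 < a /\ d < pi, [/\ a <= b, b <= c & c <= d],
      [/\ line_x a y = l, line_x b y = r, line_x c y = l & line_x d y = r],
      [/\ forall t, a <= t <= b -> 0 <= dline_x t y,
          forall t, b <= t <= c -> dline_x t y <= 0
        & forall t, c <= t <= d -> 0 <= dline_x t y]
    & (forall t : R, 0 < t < pi -> t <= a \/ d <= t -> steiner_poly (line_x t y, y) <= 0)
      /\ (forall x, x <= l \/ r <= x -> steiner_poly (x, y) <= 0)].
Proof.
move=> /andP[y0 ye]; have p0 := pi_gt0 R.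
have e0 : eta 0 = 0 by rewrite /eta sin0 mulr0 mul0r.
have ep : eta pi = 0 by rewrite /eta sinpi mulr0 mul0r.
have [|||a + ea] := @IVT R eta 0 (pi / 3) y; rewrite ?e0 ?ep.
- by lra.
- by apply: continuous_subspaceT => t; exact: continuous_eta.
- by rewrite ge_min le_max (ltW y0) (ltW ye) orbT.
rewrite in_itv /= => /andP[a0 ap].
have {}a0 : 0 < a by rewrite lt_neqAle a0 andbT; apply: contraTneq y0 => aa; rewrite -ea -aa e0 ltxx.
have {}ap : a < pi / 3.
  by rewrite lt_neqAle ap andbT; apply: contraTneq ye => aa; rewrite -ea aa ltxx.
have [|||d + ed] := @IVT R eta (pi / 3) pi y; rewrite ?e0 ?ep.
- by lra.
- by apply: continuous_subspaceT => t; exact: continuous_eta.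
- by rewrite ge_min le_max (ltW y0) (ltW ye) orbT.
rewrite in_itv /= => /andP[dp dpi].
have {}dpi : d < pi by rewrite lt_neqAle dpi andbT; apply: contraTneq y0 => aa; rewrite -ed aa ep ltxx.
have {}dp : pi / 3 < d.
  by rewrite lt_neqAle dp andbT; apply: contraTneq ye => aa; rewrite -ed -aa ltxx.
pose b : R := (pi - d) / 2; pose c : R := (pi - a) / 2.
have dE : d = pi - 2 * b by rewrite /b; field.
have aE : a = pi - 2 * c by rewrite /c; field.
have kb : kappa b = y by rewrite kappaE -dE.
have kc : kappa c = y by rewrite kappaE -aE.
have bp : 0 < b < pi / 3 by rewrite /b; lra.
have cp : pi / 3 < c < pi / 2 by rewrite /c; lra.
(* kappa inherits its monotonicity from eta, as pi - 2 t reverses the order *)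
have kincr (s t : R) : 0 <= s -> s <= t -> t <= pi / 3 -> kappa s <= kappa t.
  by move=> s0 st tp; rewrite !kappaE; apply: le_eta_decr; lra.
have kdecr (s t : R) : pi / 3 <= s -> s <= t -> t <= pi / 2 -> kappa t <= kappa s.
  by move=> s0 st tp; rewrite !kappaE; apply: le_eta_incr; lra.
have ab : a <= b.
  rewrite leNgt; apply/negP => ba.
  have := kincr b a; have : kappa a < eta a by apply: kappa_lt_eta; [lra | rewrite lt_eqF].
  by rewrite kb ea; lra.
have cd : c <= d.
  rewrite leNgt; apply/negP => dc.
  have := kdecr d c; have : kappa d < eta d by apply: kappa_lt_eta; [lra | rewrite gt_eqF].
  by rewrite kc ed; lra.
have out (t : R) : 0 < t < pi -> t <= a \/ d <= t -> steiner_poly (line_x t y, y) <= 0.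
  move=> t0 tad; apply: steiner_poly_line_le0 => //.
  by case: tad => ?; [rewrite -ea; apply: le_eta_incr | rewrite -ed; apply: le_eta_decr]; lra.
have sg (t : R) : 0 < t < pi -> 0 < sin t ^+ 2 by move=> t0; rewrite exprn_gt0 // sin_gt0_pi.
exists a, b, c, d, (line_x a y), (line_x d y); split.
- by [].
- by split=> //; lra.
- by split=> //; rewrite ?aE ?dE line_x_double //; lra.
- split=> t tab; have s0 := sg t.
  + rewrite /dline_x divr_ge0 ?(ltW (s0 _)) // ?subr_ge0 -?kb; try lra.
    by apply: kincr; lra.
  + rewrite /dline_x; apply: mulr_le0_ge0; last by rewrite invr_ge0 ltW // s0; lra.
    rewrite subr_le0; have [tp|tp] := leP t (pi / 3).
      by rewrite -{1}kb; apply: kincr; lra.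
    by rewrite -{1}kc; apply: kdecr; lra.
  + rewrite /dline_x divr_ge0 ?(ltW (s0 _)) // ?subr_ge0; try lra.
    have [tp|tp] := leP t (pi / 2); first by rewrite -kc; apply: kdecr; lra.
    apply: le_trans (ltW y0).
    rewrite /kappa mulr_ge0_le0 //.
      apply: mulr_ge0 => //; apply: exprn_ge0; apply/ltW/sin_gt0_pi; lra.
    by apply: ltW; rewrite -(@cos_pihalf R) ltr_cos ?in_itv /=; lra.
- split=> // x [xl|xr].
    have a0pi : 0 < a < pi by lra.
    have [phi phi0 <-] := line_x_surj_le _ _ _ a0pi y0 xl.
    by apply: out; lra.
  have d0pi : 0 < d < pi by lra.
  have [phi phi0 <-] := line_x_surj_ge _ _ _ d0pi y0 xr.
  by apply: out; lra.
Qed.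

End Lines.

(** * Covering slices and chords *)

Section Slices.
Context {R : realType}.
Notation mu := (@lebesgue_measure R).

Lemma integrable_continuous_support (h : R -> R) (a b : R) :
  continuous h -> (forall x, x <= a \/ b <= x -> h x = 0) ->
  mu.-integrable setT (EFin \o h).
Proof.
move=> ch h0.
have -> : EFin \o h = (EFin \o h) \_ `[a, b].
  apply/funext => x; rewrite patchE; case: ifPn => // /negP xab.
  rewrite /= h0 //; case: (leP x a) => xa; [by left | right].
  rewrite leNgt; apply/negP => xb; apply: xab; rewrite inE /= in_itv /=; lra.
apply/integrable_restrict => //; rewrite setTI.
apply: continuous_compact_integrable; first exact: segment_compact.
exact: continuous_subspaceT.
Qed.

Lemma integral_support (f : R -> R) (A B : set R) :
  B `<=` A -> (forall t, A t -> ~ B t -> f t = 0) ->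
  (\int[mu]_(t in A) (f t)%:E = \int[mu]_(t in B) (f t)%:E)%E.
Proof.
move=> BA f0; rewrite [LHS]integral_mkcond [RHS]integral_mkcond.
apply: eq_integral => t _; rewrite !patchE.
have [tB|tB] := boolP (t \in B).
  by rewrite ifT // inE; apply: BA; rewrite -inE.
case: ifPn => // tA; rewrite f0 //; first by rewrite -inE.
by move=> Bt; move: tB; rewrite mem_set.
Qed.

(** Every point of a horizontal slice lies on three tangent lines.  For y = 0 the
    statement fails, as one of the three lines is the axis itself. *)
Lemma integral_tangent_cover (h : R -> R) (y : R) : y != 0 ->
  continuous h -> mu.-integrable setT (EFin \o h) ->
  (forall x, steiner_poly (x, y) <= 0 -> h x = 0) ->
  (\int[mu]_(t in `](0%R : R), (pi : R)[) (h (line_x t y) * `|dline_x t y|)%:E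
   = 3%:E * \int[mu]_x (h x)%:E)%E.
Proof.
move=> y0 ch ih h0.
have [yhi|ylo] := leP (eta (pi / 3)) `|y|.
  have P0 x : steiner_poly (x, y) <= 0.
    have := steiner_poly_high x `|y| yhi; case: (ger0P y) => // _.
    by rewrite steiner_polyN.
  rewrite !integral0_eq ?mule0 // => x _; first by rewrite h0.
  by rewrite h0 ?mul0r.
have restr (a d : R) : 0 < a -> d < pi ->
    (forall t : R, 0 < t < pi -> t <= a \/ d <= t -> steiner_poly (line_x t y, y) <= 0) ->
    (\int[mu]_(t in `](0%R : R), (pi : R)[) (h (line_x t y) * `|dline_x t y|)%:E
     = \int[mu]_(t in `[a, d]) (h (line_x t y) * `|dline_x t y|)%:E)%E.
  move=> a0 dp out; apply: integral_support => t /=; rewrite !in_itv /=; first lra.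
  move=> t0 tad; rewrite h0 ?mul0r //; apply: out => //.
  case: (leP t a) => ta; [by left | right].
  by rewrite leNgt; apply/negP => td; apply: tad; lra.
have [ypos|yneg] := ltP 0 y.
  have [|a [b [c [d [l [r [[a0 dp] [ab bc cd] [ua ub uc ud] [s1 s2 s3] [out lr]]]]]]]] := slice_points y.
    by move: ylo; rewrite gtr0_norm // => ->; rewrite ypos.
  rewrite (restr a d) //.
  have du (t : R) : a <= t <= d -> is_derive t 1 (line_x^~ y) (dline_x t y).
    by move=> tad; apply: is_derive_line_x; lra.
  have cu t : a <= t <= d -> {for t, continuous (dline_x^~ y)}.
    by move=> tad; apply: continuous_dline_x; lra.
  apply: (@integral_fold3 _ h (line_x^~ y) (dline_x^~ y) a b c d l r 1) => //.
  - by move=> x xlr; apply/h0/lr.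
  - by left.
  - by split=> t tt; rewrite mul1r; [exact: s1 | exact: s2 | exact: s3].
have y0' : 0 < - y by rewrite oppr_gt0 lt_neqAle y0.
have [|a [b [c [d [l [r [[a0 dp] [ab bc cd] [ua ub uc ud] [s1 s2 s3] [out lr]]]]]]]] := slice_points (- y).
  by move: ylo; rewrite ler0_norm // => ->; rewrite y0'.
(* reflection in the x-axis maps the line of parameter t to that of pi - t *)
have lE t : line_x t y = line_x (pi - t) (- y).
  by rewrite /line_x (addrC pi) sinDpi cosDpi sinN cosN opprK sqrrN !mulNr mulrN opprK.
have dlE t : dline_x t y = - dline_x (pi - t) (- y).
  by rewrite /dline_x /kappa (addrC pi) sinDpi cosDpi sinN cosN opprK -[RHS]mulNr; congr (_ * _); ring.
rewrite (restr (pi - d) (pi - a)); first last.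
- move=> t t0 tad; rewrite lE -(opprK y) steiner_polyN opprK.
  by apply: out; lra.
- by rewrite ltrBlDr ltrDl.
- by rewrite subr_gt0.
have du (t : R) : pi - d <= t <= pi - a -> is_derive t 1 (line_x^~ y) (dline_x t y).
  by move=> tad; apply: is_derive_line_x; lra.
have cu t : pi - d <= t <= pi - a -> {for t, continuous (dline_x^~ y)}.
  by move=> tad; apply: continuous_dline_x; lra.
apply: (@integral_fold3 _ h (line_x^~ y) (dline_x^~ y)
  (pi - d) (pi - c) (pi - b) (pi - a) l r (-1)) => //.
- by move=> x xlr; apply: h0; rewrite -(opprK y) steiner_polyN; exact: lr.
- by split; lra.
- by right; rewrite !lE !subKr.
- split=> t tt; rewrite dlE mulrNN mul1r; [apply: s3 | apply: s2 | apply: s1]; lra.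
Qed.

(** The height of the point of angle beta on the chord of the line of parameter
    phi, where arg u1 = beta - phi and arg u3 = - beta - phi. *)
Definition line_y (phi beta : R) : R := 2 / 3 * sin phi * (cos phi - cos beta).

(** Opposite angles beta give the same point of the chord. *)
Lemma integral_line_cover (k : R -> R) (phi : R) : 0 < phi < pi -> continuous k ->
  (forall y, steiner_poly (line_x phi y, y) <= 0 -> k y = 0) ->
  (\int[mu]_(t in `[(- (pi : R))%R, (pi : R)]) (k (line_y phi t) * `|2 / 3 * sin phi * sin t|)%:E
   = 2%:E * \int[mu]_y (k y)%:E)%E.
Proof.
move=> phi0 ck k0; have sp := sin_gt0_pi phi0; have p0 := pi_gt0 R.
have k0' y : y <= line_y phi 0 \/ line_y phi pi <= y -> k y = 0.
  rewrite /line_y cos0 cospi => hy; apply: k0; rewrite steiner_poly_line ?gt_eqF //.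
  apply: mulr_ge0_le0.
    apply: divr_ge0; last by rewrite exprn_ge0 // ltW.
    by apply: mulr_ge0; rewrite ?sqr_ge0.
  by case: hy => hy; [apply: mulr_le0_ge0 | apply: mulr_ge0_le0]; lra.
have du (t : R) : - pi <= t <= pi -> is_derive t 1 (line_y phi) (2 / 3 * sin phi * sin t).
  move=> _; have := is_derive_cos t => dc; rewrite /line_y; apply: is_derive_eq.
  by rewrite /GRing.scale /=; ring.
have cu (t : R) : - pi <= t <= pi -> {for t, continuous (fun t => 2 / 3 * sin phi * sin t)}.
  by move=> _; apply: cvgM; [exact: cvg_cst | exact: continuous_sin].
have ik := integrable_continuous_support k _ _ ck k0'.
have p00 : - pi <= (0 : R) <= pi by lra.
apply: (@integral_fold2 _ k (line_y phi) _ (- pi) 0 pi _ _ ck ik k0' p00 du cu) => //.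
- by rewrite /line_y cosN.
- move=> t tp; have : 0 <= sin (- t) by apply: sin_ge0_pi; lra.
  by rewrite sinN => st; apply: mulr_ge0_le0; [apply: mulr_ge0 => //; exact: ltW | lra].
- move=> t tp; apply: mulr_ge0; last by apply: sin_ge0_pi.
  by apply: mulr_ge0 => //; exact: ltW.
Qed.

End Slices.

Lemma cos_double {R : realType} (t : R) : cos (2 * t) = 2 * cos t ^+ 2 - 1.
Proof.
have -> : 2 * t = t + t by ring.
by rewrite cosD; have := sqr_sinE t => h; ring: h.
Qed.

Lemma sin_double {R : realType} (t : R) : sin (2 * t) = 2 * sin t * cos t.
Proof. by have -> : 2 * t = t + t by [ring]; rewrite sinD; ring. Qed.

Lemma cos_triple {R : realType} (t : R) : cos (3 * t) = 4 * cos t ^+ 3 - 3 * cos t.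
Proof.
have -> : 3 * t = 2 * t + t by ring.
by rewrite cosD cos_double sin_double; have := sqr_sinE t => h; ring: h.
Qed.

Definition hypo_x {R : realType} (phi t : R) : R :=
  (cos (2 * phi) + 2 * cos phi * cos t) / 3.
Definition hypo_y {R : realType} (phi t : R) : R :=
  (sin (2 * phi) - 2 * sin phi * cos t) / 3.
(** A quarter of the squared Weyl denominator, cf. [torus_hypo]. *)
Definition weyl_weight {R : realType} (phi t : R) : R :=
  (cos (3 * phi) - cos t) ^+ 2 * sin t ^+ 2.

Lemma line_hypo_x {R : realType} (phi t : R) : 0 < phi < pi ->
  line_x phi (line_y phi t) = hypo_x phi t.
Proof.
move=> /sin_ne0 s0; rewrite /line_x /line_y /hypo_x cos_double.
by field.
Qed.

Lemma line_hypo_y {R : realType} (phi t : R) : line_y phi t = hypo_y phi t.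
Proof. by rewrite /line_y /hypo_y sin_double; field. Qed.

(** The square root in the weight, the Jacobian of the slices and that of the chords
    multiply to a trigonometric polynomial: each of them is the absolute value
    of an elementary expression whose product is nonnegative. *)
Lemma line_density {R : realType} (phi t : R) : 0 < phi < pi ->
  Num.sqrt (steiner_poly (line_x phi (line_y phi t), line_y phi t))
    * `|dline_x phi (line_y phi t)| * `|2 / 3 * sin phi * sin t|
  = 16 / (27 * Num.sqrt 3) * weyl_weight phi t.
Proof.
move=> phi0; have s0 := sin_ne0 phi phi0.
have r3 : Num.sqrt 3 ^+ 2 = 3 :> R by rewrite sqr_sqrtr.
have r0 : Num.sqrt 3 != 0 :> R by rewrite sqrtr_eq0 -ltNge.
(* the square root of the quartic along the chord, up to sign *)
pose a : R := 2 / Num.sqrt 3 * (line_y phi t - kappa phi) * sin t / sin phi.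
have -> : steiner_poly (line_x phi (line_y phi t), line_y phi t) = a ^+ 2.
  rewrite steiner_poly_line // /a !exprMn exprVn exprVn r3 (sqr_sinE t) /line_y.
  by move: (kappa phi) (cos phi) (cos t) s0 => u c d; set s := sin phi => s0; field.
rewrite sqrtr_sqr -!normrM.
have -> : a * dline_x phi (line_y phi t) * (2 / 3 * sin phi * sin t) =
  16 / (27 * Num.sqrt 3) * weyl_weight phi t.
  rewrite /a /dline_x /weyl_weight /kappa /line_y cos_triple.
  move: r0 s0; have := sqr_sinE phi; set s := sin phi; set c := cos phi; set d := cos t.
  set e := sin t; set r := Num.sqrt 3 => h r0 s0; field: h.
  by rewrite s0 r0.
by rewrite ger0_norm // /weyl_weight; apply: mulr_ge0; [apply: divr_ge0 | apply: mulr_ge0; exact: sqr_ge0].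
Qed.

(** * The integral over the hypocycloid as an integral over the torus *)

Section Cover.
Context {R : realType}.
Notation mu := (@lebesgue_measure R).
Notation mu2 := (@lebesgue2 R).

Lemma continuous_pair (u v : R -> R) (x : R) :
  {for x, continuous u} -> {for x, continuous v} ->
  {for x, continuous (fun t => (u t, v t))}.
Proof.
move=> cu cv.
exact: (@cvg_pair _ _ _ (nbhs x) (nbhs (u x)) (nbhs (v x)) _ _ _ u v cu cv).
Qed.

(** With z = x + i y, the difference of the two sides is
    2 |z ^ 2 - 2 conj z| ^ 2. *)
Lemma steiner_poly_le (x y : R) :
  steiner_poly (x, y) <= 2 - (x ^+ 2 + y ^+ 2 - 1) ^+ 2.
Proof.
rewrite -subr_ge0.
have -> : 2 - (x ^+ 2 + y ^+ 2 - 1) ^+ 2 - steiner_poly (x, y) =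
  2 * ((x ^+ 2 - y ^+ 2 - 2 * x) ^+ 2 + (2 * x * y + 2 * y) ^+ 2).
  by rewrite /steiner_poly /=; ring.
by rewrite mulr_ge0 // addr_ge0 ?sqr_ge0.
Qed.

Lemma steiner_poly_support (x y : R) : 2 <= `|x| \/ 2 <= `|y| ->
  steiner_poly (x, y) <= 0.
Proof.
move=> xy; apply: le_trans (steiner_poly_le x y) _.
have : 4 <= x ^+ 2 + y ^+ 2.
  have big (t : R) : 2 <= `|t| -> 4 <= t ^+ 2 by rewrite -real_normK ?num_real // => ?; nra.
  by have := sqr_ge0 x; have := sqr_ge0 y; case: xy => /big; lra.
by move: (_ + _) => r ?; nra.
Qed.

Lemma continuous_steiner_poly : continuous (@steiner_poly R).
Proof.
move=> p; have cx : {for p, continuous (fun q : R * R => q.1)} by exact: cvg_fst.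
have cy : {for p, continuous (fun q : R * R => q.2)} by exact: cvg_snd.
have cX (u : R * R -> R) n : {for p, continuous u} -> {for p, continuous (fun q => u q ^+ n)}.
  by move=> cu; apply: (@continuous_comp _ _ _ u (fun x : R => x ^+ n)) => //; exact: exprn_continuous.
have cM (u v : R * R -> R) : {for p, continuous u} -> {for p, continuous v} ->
  {for p, continuous (fun q => u q * v q)} by move=> cu cv; exact: cvgM.
have cD (u v : R * R -> R) : {for p, continuous u} -> {for p, continuous v} ->
  {for p, continuous (fun q => u q + v q)} by move=> cu cv; exact: cvgD.
have cN (u : R * R -> R) : {for p, continuous u} ->
  {for p, continuous (fun q => - u q)} by move=> cu; exact: cvgN.
have cC (a : R) : {for p, continuous (fun q : R * R => a)} by exact: cvg_cst.
rewrite /steiner_poly.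
exact: (cD _ _ (cD _ _ (cM _ _ (cC (-3)) (cX _ 2%N (cD _ _ (cD _ _ (cX _ 2%N cx)
  (cX _ 2%N cy)) (cC 1)))) (cM _ _ (cC 8) (cD _ _ (cX _ 3%N cx)
  (cN _ (cM _ _ (cM _ _ (cC 3) cx) (cX _ 2%N cy)))))) (cC 4)).
Qed.

Lemma measurable_steiner_poly : measurable_fun setT (@steiner_poly R).
Proof.
have mx : measurable_fun setT (fun q : R * R => q.1) by exact: measurable_fst.
have my : measurable_fun setT (fun q : R * R => q.2) by exact: measurable_snd.
have mX (u : R * R -> R) n : measurable_fun setT u -> measurable_fun setT (fun q => u q ^+ n).
  by move=> hu; exact: measurable_funX.
have mM (u v : R * R -> R) : measurable_fun setT u -> measurable_fun setT v ->
  measurable_fun setT (fun q => u q * v q) by move=> hu hv; exact: measurable_funM.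
have mD (u v : R * R -> R) : measurable_fun setT u -> measurable_fun setT v ->
  measurable_fun setT (fun q => u q + v q) by move=> hu hv; exact: measurable_funD.
have mN (u : R * R -> R) : measurable_fun setT u ->
  measurable_fun setT (fun q => - u q) by move=> hu; exact: measurable_funN.
have mC (a : R) : measurable_fun setT (fun q : R * R => a) by exact: measurable_cst.
exact: (mD _ _ (mD _ _ (mM _ _ (mC (-3)) (mX _ 2%N (mD _ _ (mD _ _ (mX _ 2%N mx)
  (mX _ 2%N my)) (mC 1)))) (mM _ _ (mC 8) (mD _ _ (mX _ 3%N mx)
  (mN _ (mM _ _ (mM _ _ (mC 3) mx) (mX _ 2%N my)))))) (mC 4)).
Qed.

Variable f : R * R -> R.
Hypothesis cf : continuous f.
Hypothesis mf : measurable_fun setT f.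
Variable K : R.
Hypothesis fK : forall x y, `|x| <= 2 -> `|y| <= 2 -> `|f (x, y)| <= K.

Let g (p : R * R) : R := f p * Num.sqrt (steiner_poly p).

Let cg : continuous g.
Proof.
move=> p; apply: cvgM; first exact: cf.
apply: (@continuous_comp _ _ _ (@steiner_poly R) Num.sqrt).
  exact: continuous_steiner_poly.
exact: sqrt_continuous.
Qed.

Let mg : measurable_fun setT g.
Proof.
apply: measurable_funM => //.
apply: (measurableT_comp _ measurable_steiner_poly).
by apply: continuous_measurable_fun; exact: sqrt_continuous.
Qed.

Let g0 p : steiner_poly p <= 0 -> g p = 0.
Proof. by move=> p0; rewrite /g ler0_sqrtr // mulr0. Qed.

Lemma integrable_sqrt_steiner :
  mu2.-integrable setT (fun p => (f p * Num.sqrt (steiner_poly p))%:E).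
Proof.
suff : mu2.-integrable setT (EFin \o g) by [].
pose box : set (R * R) := `[(-2 : R), 2] `*` `[(-2 : R), 2].
have mbox : measurable box by apply: measurableX; exact: measurable_itv.
apply: (@le_integrable _ _ _ mu2 setT measurableT _ (fun p => (2 * K)%:E * (\1_box p)%:E)%E).
- exact/measurable_EFinP.
- move=> [x y] _ /=; rewrite lee_fin.
  have [P0|P0] := leP (steiner_poly (x, y)) 0; first by rewrite g0 // normr0.
  have [x2 y2] : `|x| <= 2 /\ `|y| <= 2.
    by split; apply: ltW; apply: contraTT P0; rewrite -!leNgt => xy;
      apply: steiner_poly_support; tauto.
  rewrite indicE mem_set ?mulr1; last by rewrite /box /= !in_itv /= -!ler_norml.
  have K0 : 0 <= K by apply: le_trans (fK x y x2 y2).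
  rewrite [leRHS]ger0_norm ?mulr_ge0 // /g normrM mulrC.
  apply: ler_pM => //; last exact: fK.
  rewrite ger0_norm ?sqrtr_ge0 // -[leRHS]ger0_norm // -sqrtr_sqr ler_sqrt ?sqr_ge0 //.
  apply: le_trans (steiner_poly_le x y) _; have := sqr_ge0 (x ^+ 2 + y ^+ 2 - 1); lra.
- apply: integrableZl => //; apply/integrableP; split.
    exact/measurable_EFinP/measurable_indic.
  under eq_integral do rewrite gee0_abs //.
  rewrite integral_indic // setIT.
  have boxE : mu2 box = (mu `[(-2)%R : R, 2%R] * mu `[(-2)%R : R, 2%R])%E.
    by apply: product_measure1E; exact: measurable_itv.
  apply: (eq_ind_r (fun z : \bar R => (z < +oo)%E) _ boxE).
  by rewrite !lebesgue_measure_itv /=; case: ifP => _; rewrite ?mule0 ?ltry // -EFinD -EFinM ltry.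
Qed.

Let ct : R -> R := (fun t : R => cos t / sin t) \_ `]0%R, (pi : R)[.
Let iq : R -> R := (fun t : R => (sin t ^+ 2)^-1) \_ `]0%R, (pi : R)[.
(** The density on the space of pairs (phi, y).  The factors with a pole are cut off
    outside of ]0, pi[, which makes k globally measurable. *)
Let k (q : R * R) : R := g ((4 * cos q.1 ^+ 2 - 1) / 3 - q.2 * ct q.1, q.2)
  * `|(q.2 - kappa q.1) * iq q.1|.

Let kE (phi y : R) : 0 < phi < pi -> k (phi, y) = g (line_x phi y, y) * `|dline_x phi y|.
Proof. by move=> phi0; rewrite /k /ct /iq /= !patchE !mem_set //= in_itv. Qed.

Let k0 (phi y : R) : ~ (0 < phi < pi) -> k (phi, y) = 0.
Proof.
move=> phi0; rewrite /k /iq /= patchE memNset ?mulr0 ?normr0 ?mulr0 //.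
Qed.

Let cont_meas (u : R -> R) : continuous u -> measurable_fun setT (fun q : R * R => u q.1).
Proof.
move=> cu; apply: (@measurableT_comp _ _ _ _ _ _ u _ fst); last exact: measurable_fst.
exact: continuous_measurable_fun.
Qed.

Let patch_meas (u : R -> R) : {in `]0, (pi : R)[%classic, continuous u} ->
  measurable_fun setT (fun q : R * R => (u \_ `]0, (pi : R)[) q.1).
Proof.
move=> cu; apply: (@measurableT_comp _ _ _ _ _ _ (u \_ _) _ fst); last exact: measurable_fst.
have mI : measurable (`]0%R, (pi : R)[ : set R) by exact: measurable_itv.
apply/(measurable_restrictT u mI).
by apply: open_continuous_measurable_fun => //; exact: interval_open.
Qed.

Let mk : measurable_fun setT k.
Proof.
have m2 : measurable_fun setT (fun q : R * R => q.2) by exact: measurable_snd.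
have mct : measurable_fun setT (fun q : R * R => ct q.1).
  apply: patch_meas => t; rewrite inE /= in_itv /= => t0.
  apply: cvgM; first exact: continuous_cos.
  by apply: cvgV; [exact: sin_ne0 | exact: continuous_sin].
have csX n : continuous (fun t : R => sin t ^+ n).
  move=> t; apply: (@continuous_comp _ _ _ sin (fun x : R => x ^+ n)).
    exact: continuous_sin.
  exact: exprn_continuous.
have miq : measurable_fun setT (fun q : R * R => iq q.1).
  apply: patch_meas => t; rewrite inE /= in_itv /= => t0.
  by apply: cvgV; [rewrite expf_neq0 // sin_ne0 | exact: csX].
have mkap : measurable_fun setT (fun q : R * R => kappa q.1).
  apply: cont_meas => t; apply: cvgM; last exact: continuous_cos.
  by apply: cvgM; [exact: cvg_cst | exact: csX].
have mcos : measurable_fun setT (fun q : R * R => cos q.1).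
  by apply: cont_meas; exact: continuous_cos.
apply: measurable_funM.
  apply: (measurableT_comp mg); apply: measurable_fun_pair => //.
  apply: measurable_funB; last exact: measurable_funM.
  apply: measurable_funM => //; apply: measurable_funB => //.
  by apply: measurable_funM => //; exact: measurable_funX.
apply: (measurableT_comp (@normr_measurable R setT)).
by apply: measurable_funM => //; exact: measurable_funB.
Qed.

Let cgx y : continuous (fun x => g (x, y)).
Proof.
move=> x; apply: (@continuous_comp _ _ _ (fun x => (x, y)) g); last exact: cg.
by apply: continuous_pair; [exact: cvg_id | exact: cvg_cst].
Qed.

(** Stated for a positively homogeneous u, in order to apply to both k and |k|. *)
Let integral_k (u : R -> R) y : y != 0 -> continuous u -> u 0 = 0 ->
  (forall a b : R, u (a * `|b|) = u a * `|b|) ->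
  (\int[mu]_t (u (k (t, y)))%:E = \int[mu]_x (3 * u (g (x, y)))%:E)%E.
Proof.
move=> y0 cu u0 uM.
have cug : continuous (fun x => u (g (x, y))).
  by move=> x; apply: (@continuous_comp _ _ _ (fun x => g (x, y)) u); [exact: cgx | exact: cu].
have ug0 x : steiner_poly (x, y) <= 0 -> u (g (x, y)) = 0 by move=> /g0 ->.
have iug : mu.-integrable setT (EFin \o (fun x => u (g (x, y)))).
  apply: (@integrable_continuous_support _ _ (-2) 2) => // x x2.
  by apply: ug0; apply: steiner_poly_support; left; rewrite ler_normr; lra.
under [RHS]eq_integral do rewrite EFinM.
rewrite integralZl // -(integral_tangent_cover _ y y0 cug) //.
rewrite (@integral_support _ (fun t => u (k (t, y))) setT `]0%R, (pi : R)[) //; last first.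
  by move=> t _; rewrite /= in_itv /= => t0; rewrite k0.
apply: eq_integral => t; rewrite inE /= in_itv /= => t0.
by rewrite kE // uM.
Qed.

Let ae_ne0 (F G : R -> \bar R) : measurable_fun setT F -> measurable_fun setT G ->
  (forall y, y != 0 -> F y = G y) -> (\int[mu]_y F y = \int[mu]_y G y)%E.
Proof.
move=> mF mG FG; apply: ae_eq_integral => //.
exists [set 0]; split => //; first exact: lebesgue_measure_set1.
move=> y /= h; apply: contrapT => /eqP y0; apply: h => _; exact: FG.
Qed.

Let tonelli_meas (F : R * R -> \bar R) : measurable_fun setT F ->
  (forall p, 0 <= F p)%E -> measurable_fun setT (fun y => \int[mu]_x F (x, y))%E.
Proof. by move=> mF F0; exact: (@measurable_fun_fubini_tonelli_G _ _ _ _ R mu F mF F0). Qed.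

Let fubini_meas (F : R * R -> \bar R) : mu2.-integrable setT F ->
  measurable_fun setT (fun y => \int[mu]_x F (x, y))%E.
Proof. by move=> iF; exact: (@measurable_fubini_G _ _ _ _ R mu mu F iF). Qed.

(** By Tonelli's theorem, the covering formula for |g| bounds the integral of |k|. *)
Let integrable_k : mu2.-integrable setT (EFin \o k).
Proof.
have mEk : measurable_fun setT (EFin \o k) by exact/measurable_EFinP.
have mEg : measurable_fun setT (EFin \o g) by exact/measurable_EFinP.
apply: (proj2 (integrable21ltyP mu mu mEk)).
have ig3 : mu2.-integrable setT (fun p => 3%:E * (EFin \o g) p)%E by apply: integrableZl => //; exact: integrable_sqrt_steiner.
have mg3 := measurable_int _ ig3.
have := proj1 (integrable21ltyP mu mu mg3) ig3.
apply: le_lt_trans; rewrite le_eqVlt; apply/orP; left; apply/eqP.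
apply: ae_ne0.
- apply: (tonelli_meas (abse \o (EFin \o k))) => [|p]; last exact: abse_ge0.
  exact: measurableT_comp.
- apply: (tonelli_meas (abse \o (fun p => 3%:E * (EFin \o g) p)%E)) => [|p]; last exact: abse_ge0.
  exact: measurableT_comp.
move=> y y0 /=.
rewrite (integral_k (fun x => `|x|) y y0); first last.
- by move=> a b; rewrite normrM normr_id.
- exact: normr0.
- exact: norm_continuous.
by apply: eq_integral => x _; rewrite (normrM 3) (@ger0_norm R 3).
Qed.

Let integral_lines (phi : R) : 0 < phi < pi ->
  (2%:E * \int[mu]_y (k (phi, y))%:E = \int[mu]_(t in `[(- (pi : R))%R, (pi : R)])
     (16 / (27 * Num.sqrt 3) * (f (hypo_x phi t, hypo_y phi t) * weyl_weight phi t))%:E)%E.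
Proof.
move=> phi0; have s0 := sin_gt0_pi phi0; have sn := sin_ne0 phi phi0.
rewrite -(integral_line_cover (fun y => k (phi, y)) phi) //; first last.
- by move=> y P0; rewrite kE // g0 // mul0r.
- have -> : (fun y => k (phi, y)) = (fun y => g (line_x phi y, y) * `|dline_x phi y|).
    by apply/funext => y; rewrite kE.
  move=> y; apply: cvgM.
    apply: (@continuous_comp _ _ _ (fun y => (line_x phi y, y)) g); last exact: cg.
    apply: continuous_pair; last exact: cvg_id.
    by apply: cvgB; [exact: cvg_cst | apply: cvgM; [exact: cvg_id | exact: cvg_cst]].
  apply: cvg_norm; apply: cvgM; last exact: cvg_cst.
  by apply: cvgB; [exact: cvg_id | exact: cvg_cst].
apply: eq_integral => t _; congr (_%:E); rewrite kE // /g.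
have := line_density phi t phi0; rewrite line_hypo_x // line_hypo_y => h.
by rewrite [RHS]mulrCA -h; ring.
Qed.

Let integral_hypocycloid_lines :
  (3%:E * \int[mu2]_p (f p * Num.sqrt (steiner_poly p))%:E
   = \int[mu]_(t in `]0%R, (pi : R)[) \int[mu]_y (k (t, y))%:E)%E.
Proof.
have ig3 : mu2.-integrable setT (fun p => (3 * g p)%:E).
  by under eq_fun do rewrite EFinM; apply: integrableZl => //; exact: integrable_sqrt_steiner.
rewrite -(integralZl measurableT integrable_sqrt_steiner); under eq_integral do rewrite -EFinM.
rewrite -(@integral21_prod_meas1 _ _ _ _ R mu mu _ ig3).
have -> : (\int[mu]_y fubini_G mu (fun p => (3 * g p)%:E) y
    = \int[mu]_y fubini_G mu (EFin \o k) y)%E.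
  apply: ae_ne0; [exact: fubini_meas | exact: fubini_meas |].
  move=> y y0; rewrite /fubini_G /=.
  by rewrite (integral_k id y y0) // => z; exact: cvg_id.
rewrite (@integral21_prod_meas1 _ _ _ _ R mu mu _ integrable_k).
rewrite -(@integral12_prod_meas1 _ _ _ _ R mu mu _ integrable_k).
rewrite [RHS]integral_mkcond; apply: eq_integral => t _.
rewrite /fubini_F patchE /=; case: ifPn => // tp.
apply: integral0_eq => y _; rewrite k0 // => t0; move: tp.
by rewrite mem_set //= in_itv.
Qed.

(** The factor 6 is 3 (tangent lines through a point) times 2 (angles beta over a
    point of a chord). *)
Lemma integral_hypocycloid_torus :
  (6%:E * \int[mu2]_p (f p * Num.sqrt (steiner_poly p))%:E
   = \int[mu]_(phi in `]0%R, (pi : R)[) \int[mu]_(t in `[(- (pi : R))%R, (pi : R)])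
     (16 / (27 * Num.sqrt 3) * (f (hypo_x phi t, hypo_y phi t) * weyl_weight phi t))%:E)%E.
Proof.
have -> : 6%:E = (2%:E * 3%:E : \bar R)%E by rewrite -EFinM; congr (_%:E); ring.
rewrite -muleA integral_hypocycloid_lines.
have iF := @integrable_fubini_F _ _ _ _ R mu mu _ integrable_k.
rewrite -integralZl //; last first.
  by apply: (@integrableS _ _ _ mu setT) => //; exact: measurable_itv.
apply: eq_integral => phi; rewrite inE /= in_itv /= => phi0.
exact: integral_lines.
Qed.

End Cover.

(** * Trigonometric polynomials and equidistant sums *)

Section TrigPoly.
Context {R : realType}.
Notation mu := (@lebesgue_measure R).
Implicit Types (p q : int) (F G : R -> R -> R).

(** The frequencies (p, q) of a product of d of the numbers u_k and their conjugates
    satisfy these bounds: they form a hexagon.  The phase c makes sines a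
    special case of cosines. *)
Inductive trigpoly (d : nat) : (R -> R -> R) -> Prop :=
| trig_cos p q c : `|p| <= d%:Z -> `|q| <= d%:Z -> `|p - q| <= d%:Z ->
    trigpoly d (fun a b => cos (p%:~R * a + q%:~R * b + c))
| trig_add F G : trigpoly d F -> trigpoly d G ->
    trigpoly d (fun a b => F a b + G a b)
| trig_scale c F : trigpoly d F -> trigpoly d (fun a b => c * F a b).

Lemma eq_trigpoly d F G : (forall a b, F a b = G a b) -> trigpoly d F -> trigpoly d G.
Proof. by move=> FG; have -> : F = G by apply/funext => a; apply/funext => b. Qed.

Lemma trigpolyW d e F : (d <= e)%N -> trigpoly d F -> trigpoly e F.
Proof.
move=> de; elim=> [p q c hp hq hpq|{}F G _ hF _ hG|c {}F _ hF].
- by apply: trig_cos; lia.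
- exact: trig_add.
- exact: trig_scale.
Qed.

Lemma trigpoly_cst d (c : R) : trigpoly d (fun _ _ => c).
Proof.
apply: (@eq_trigpoly _ (fun a b => c * cos (0%:~R * a + 0%:~R * b + 0))).
  by move=> a b; rewrite !mul0r !addr0 cos0 mulr1.
by apply/trig_scale/trig_cos; lia.
Qed.

Lemma trigpolyM d e F G : trigpoly d F -> trigpoly e G ->
  trigpoly (d + e) (fun a b => F a b * G a b).
Proof.
move=> hF hG; elim: hF => [p q c hp hq hpq|F1 F2 _ h1 _ h2|c {}F _ hF].
- elim: hG => [p' q' c' hp' hq' hpq'|G1 G2 _ h1 _ h2|c' {}G _ hG].
  + apply: (@eq_trigpoly _ (fun a b => 2^-1 *
      (cos ((p + p')%:~R * a + (q + q')%:~R * b + (c + c'))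
       + cos ((p - p')%:~R * a + (q - q')%:~R * b + (c - c'))))).
      move=> a b; rewrite !intrD !intrN.
      have -> : (p%:~R + p'%:~R) * a + (q%:~R + q'%:~R) * b + (c + c') =
        (p%:~R * a + q%:~R * b + c) + (p'%:~R * a + q'%:~R * b + c') by ring.
      have -> : (p%:~R - p'%:~R) * a + (q%:~R - q'%:~R) * b + (c - c') =
        (p%:~R * a + q%:~R * b + c) - (p'%:~R * a + q'%:~R * b + c') by ring.
      by rewrite cosD cosB; field.
    by apply/trig_scale/trig_add; apply: trig_cos; lia.
  + by apply: (eq_trigpoly _ _ _ _ (trig_add _ _ _ h1 h2)) => a b; rewrite mulrDr.
  + by apply: (eq_trigpoly _ _ _ _ (trig_scale _ c' _ hG)) => a b; rewrite mulrCA.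
- by apply: (eq_trigpoly _ _ _ _ (trig_add _ _ _ h1 h2)) => a b; rewrite mulrDl.
- by apply: (eq_trigpoly _ _ _ _ (trig_scale _ c _ hF)) => a b; rewrite mulrA.
Qed.

Lemma trigpolyX d F n : trigpoly d F -> trigpoly (n * d) (fun a b => F a b ^+ n).
Proof.
move=> hF; elim: n => [|n hn].
  by apply: (eq_trigpoly _ _ _ _ (trigpoly_cst _ 1)) => a b; rewrite expr0.
by rewrite mulSn; apply: (eq_trigpoly _ _ _ _ (trigpolyM _ _ _ _ hF hn)) => a b; rewrite exprS.
Qed.

Lemma trigpoly_sin d p q : `|p| <= d%:Z -> `|q| <= d%:Z -> `|p - q| <= d%:Z ->
  trigpoly d (fun a b => sin (p%:~R * a + q%:~R * b)).
Proof.
move=> hp hq hpq; apply: (eq_trigpoly _ _ _ _ (trig_cos _ _ _ (- (pi / 2)) hp hq hpq)).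
by move=> a b; rewrite cosBpihalf.
Qed.

Lemma cos_add_int (x : R) p : cos (x + 2 * pi * p%:~R) = cos x.
Proof.
have cosn (y : R) (n : nat) : cos (y + 2 * pi * n%:R) = cos y.
  have -> : 2 * pi * n%:R = (pi *+ 2) *+ n :> R by rewrite -[RHS]mulr_natr -[pi *+ 2]mulr_natl.
  by rewrite (periodicn (@cosD2pi R)).
case: p => n; first exact: cosn.
by rewrite NegzE mulrNz mulrN -[LHS](cosn _ n.+1) subrK.
Qed.

Lemma sin_pi_frac_neq0 p (M : nat) : (0 < M)%N -> ~~ (M%:Z %| p)%Z ->
  sin (pi * p%:~R / M%:R) != 0 :> R.
Proof.
move=> M0 Mp.
have natcase (n : nat) : ~~ (M %| n)%N -> sin (pi * n%:R / M%:R) != 0 :> R.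
  move=> Mn; have MR : M%:R != 0 :> R by rewrite pnatr_eq0 -lt0n.
  have -> : pi * n%:R / M%:R = pi * (n %% M)%:R / M%:R + pi *+ (n %/ M) :> R.
    rewrite {1}(divn_eq n M) natrD natrM -mulr_natr; field.
    by [].
  rewrite (alternatingn (@sinDpi R)) mulf_neq0 ?signr_eq0 // gt_eqF // sin_gt0_pi //.
  have r0 : (0 < n %% M)%N by rewrite lt0n.
  have rM : (n %% M < M)%N by rewrite ltn_mod.
  rewrite divr_gt0 ?mulr_gt0 ?pi_gt0 ?ltr0n //=.
  by rewrite ltr_pdivrMr ?ltr0n // ltr_pM2l ?pi_gt0 // ltr_nat.
case: p Mp => n; first by rewrite dvdzE /= => /natcase.
rewrite NegzE dvdzE abszN /= => /natcase.
by rewrite mulrNz mulrN mulNr sinN oppr_eq0.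
Qed.

(** Multiplied by 2 sin (w / 2), the sum telescopes over a full period. *)
Lemma sum_cos0 p (M : nat) (c : R) : (0 < M)%N -> ~~ (M%:Z %| p)%Z ->
  \sum_(0 <= j < M) cos (2 * pi * p%:~R / M%:R * j%:R + c) = 0.
Proof.
move=> M0 Mp; have MR : M%:R != 0 :> R by rewrite pnatr_eq0 -lt0n.
set w := 2 * pi * p%:~R / M%:R.
have s0 : 2 * sin (w / 2) != 0.
  rewrite mulf_neq0 ?pnatr_eq0 // (_ : w / 2 = pi * p%:~R / M%:R) ?sin_pi_frac_neq0 //.
  by rewrite /w; field.
apply/(mulfI s0); rewrite mulr0 big_distrr /=.
rewrite (telescope_sumr_eq (fun j => sin (w * j%:R + (c - w / 2)))) //.
  have -> : w * M%:R + (c - w / 2) = (c - w / 2) + 2 * pi * p%:~R by rewrite /w; field.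
  by rewrite -!cosBpihalf addrAC cos_add_int mulr0 add0r subrr.
move=> j _; rewrite -(natr1 j).
have -> : w * (j%:R + 1) + (c - w / 2) = (w * j%:R + c) + w / 2 by field.
have -> : w * j%:R + (c - w / 2) = (w * j%:R + c) - w / 2 by ring.
by rewrite sinD sinB; ring.
Qed.

Lemma continuous_cos_aff (k e : R) : continuous (fun t : R => cos (k * t + e)).
Proof.
move=> t; apply: (@continuous_comp _ _ _ (fun t : R => k * t + e) cos); last exact: continuous_cos.
apply: cvgD; last exact: cvg_cst.
by apply: cvgM; [exact: cvg_cst | exact: cvg_id].
Qed.

Lemma integral_cos_itv (k e a b : R) : k != 0 -> a <= b ->
  (\int[mu]_(t in `[a, b]) (cos (k * t + e))%:E
   = ((sin (k * b + e) - sin (k * a + e)) / k)%:E)%E.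
Proof.
move=> k0 ab.
have dG (x : R) : is_derive x 1 (fun t => k^-1 * sin (k * t + e)) (cos (k * x + e)).
  have := is_derive_aff (is_derive_sin (k * x + e)) => ds.
  have := is_deriveZ k^-1 ds; rewrite /GRing.scale /= => h.
  by apply: is_derive_eq; rewrite mulrCA mulVf ?mulr1.
have cg := continuous_cos_aff k e.
have := @integral_comp_derive R _ _ id (fun=> 1) a b ab cg dG.
under eq_integral do rewrite mulr1.
move=> ->.
- by congr (_%:E); ring.
- by move=> t _; exact: cvg_cst.
Qed.

Lemma integral_cst_itv (c a b : R) : a <= b ->
  (\int[mu]_(t in `[a, b]) c%:E = (c * (b - a))%:E)%E.
Proof.
move=> ab; rewrite integral_cst /=; last exact: measurable_itv.
rewrite lebesgue_measure_itv /= lte_fin; case: ifP => [|/negbT] ab'.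
  by rewrite -EFinD -EFinM.
have -> : a = b by apply/eqP; rewrite eq_le ab leNgt ab'.
by rewrite mule0 subrr mulr0.
Qed.

(** The points t = (j1 / N, j2 / N) in the coordinates (a, b) of the torus.  The
    range 3 N, rather than N, makes it a full period: z itself is only periodic
    up to third roots of unity under t_i |-> t_i + 1. *)
Definition grid_sum (N : nat) F : R :=
  \sum_(0 <= j1 < 3 * N) \sum_(0 <= j2 < 3 * N)
    F (2 * pi / (3 * N)%:R * (j1%:R + 2 * j2%:R)) (2 * pi / (3 * N)%:R * (j1%:R - j2%:R)).

(** A frequency (p, q) that the grid cannot distinguish from 0 has p + q and 2 p - q
    divisible by 3 N, so that p, q and p - q are multiples of N, at least one
    of which is at least 2 N in absolute value when they are not all 0. *)
Lemma grid_sum_cos (N : nat) p q (c : R) : (0 < N)%N ->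
  `|p| < 2 * N%:Z -> `|q| < 2 * N%:Z -> `|p - q| < 2 * N%:Z ->
  grid_sum N (fun a b => cos (p%:~R * a + q%:~R * b + c)) =
  (3 * N)%:R ^+ 2 * (if (p == 0) && (q == 0) then cos c else 0).
Proof.
move=> N0 hp hq hpq.
have [M ME] : {M | M = (3 * N)%N} by exists (3 * N)%N.
rewrite /grid_sum -!ME.
have M0 : (0 < M)%N by rewrite ME muln_gt0.
have [/andP[/eqP -> /eqP ->]|pq] := boolP ((p == 0) && (q == 0)).
  under eq_bigr do (under eq_bigr do rewrite !mul0r !add0r).
  by rewrite !sumr_const_nat subn0 -(mulr_natl (cos c *+ M)) -(mulr_natl (cos c)) mulrA expr2.
rewrite mulr0.
have termE j1 j2 : p%:~R * (2 * pi / M%:R * (j1%:R + 2 * j2%:R)) +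
    q%:~R * (2 * pi / M%:R * (j1%:R - j2%:R)) + c =
    2 * pi * (p + q)%:~R / M%:R * j1%:R + 2 * pi * (2 * p - q)%:~R / M%:R * j2%:R + c :> R.
  by rewrite !(intrD, intrN, intrM); field; rewrite pnatr_eq0 -lt0n.
have [h2|h2] := boolP (M%:Z %| (2 * p - q : int))%Z; last first.
  apply: big1 => j1 _; rewrite -[RHS](sum_cos0 (2 * p - q : int) M
    (2 * pi * (p + q)%:~R / M%:R * j1%:R + c) M0 h2).
  by apply: eq_bigr => j2 _; rewrite termE; congr cos; ring.
have [h1|h1] := boolP (M%:Z %| (p + q : int))%Z; last first.
  rewrite exchange_big /=; apply: big1 => j2 _; rewrite -[RHS](sum_cos0 (p + q : int) M
    (2 * pi * (2 * p - q)%:~R / M%:R * j2%:R + c) M0 h1).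
  by apply: eq_bigr => j1 _; rewrite termE; congr cos; ring.
(* p + q and 2 p - q are multiples of M: the degree bounds leave only 0 *)
exfalso; move/negP: pq; apply.
move: h1 h2 => /dvdzP[a aE] /dvdzP[b bE]; rewrite ME in aE bE.
have pE : p = (a + b) * N%:Z by lia.
have qE : q = (a + a - b) * N%:Z by lia.
have pqE : p - q = (b + b - a) * N%:Z by lia.
have small (x : int) : `|x * N%:Z| < 2 * N%:Z -> `|x| < 2.
  by rewrite normrM [X in _ * X]ger0_norm // ltr_pM2r.
rewrite pqE in hpq; rewrite pE in hp; rewrite qE in hq.
have ab : a = 0 /\ b = 0 by have := small _ hp; have := small _ hq; have := small _ hpq; lia.
by case: ab => a0 b0; apply/andP; split; apply/eqP; lia.
Qed.

(** For p <> 0 the integral over t vanishes, and for p = 0, q <> 0 the one over phi;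
    this coordinate system needs only half a turn of phi. *)
Lemma torus_integral_cos p q (c : R) :
  exists V : R -> R, [/\ continuous V,
    forall phi, (\int[mu]_(t in `[(- (pi : R))%R, (pi : R)])
      (cos (p%:~R * (t - phi) + q%:~R * (2 * phi) + c))%:E = (V phi)%:E)%E
  & (\int[mu]_(phi in `[0%R, (pi : R)]) (V phi)%:E
     = (2 * pi ^+ 2 * (if (p == 0) && (q == 0) then cos c else 0))%:E)%E].
Proof.
have p0 := pi_ge0 R; have pp : - pi <= pi :> R by lra.
have [-> /=|pn] := eqVneq p 0; last first.
  exists (fun=> 0); split=> [|phi|]; last by rewrite integral0 mulr0.
    by move=> x; exact: cvg_cst.
  have pR : p%:~R != 0 :> R by rewrite intr_eq0.
  transitivity (\int[mu]_(t in `[(- (pi : R))%R, (pi : R)])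
      (cos (p%:~R * t + (- p%:~R * phi + q%:~R * (2 * phi) + c)))%:E)%E.
    by apply: eq_integral => t _; congr (cos _)%:E; ring.
  rewrite integral_cos_itv //; congr (_%:E).
  set e := (_ + c).
  have -> : p%:~R * pi + e = p%:~R * - pi + e + 2 * pi * p%:~R by ring.
  by rewrite -!cosBpihalf addrAC cos_add_int subrr mul0r.
exists (fun phi => 2 * pi * cos (2 * q%:~R * phi + c)); split.
- by move=> x; apply: cvgM; [exact: cvg_cst | exact: continuous_cos_aff].
- move=> phi; under eq_integral do rewrite mul0r add0r.
  rewrite integral_cst_itv //; congr (_%:E).
  have -> : q%:~R * (2 * phi) = 2 * q%:~R * phi by ring.
  by ring.
under eq_integral do rewrite EFinM.
have ic : mu.-integrable `[0%R, (pi : R)] (fun phi => (cos (2 * q%:~R * phi + c))%:E).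
  apply: continuous_compact_integrable; first exact: segment_compact.
  apply: continuous_subspaceT; exact: continuous_cos_aff.
rewrite integralZl //.
have [->|qn] := eqVneq q 0.
  under eq_integral do rewrite mulr0 mul0r add0r.
  by rewrite integral_cst_itv // -EFinM; congr (_%:E); ring.
have qR : 2 * q%:~R != 0 :> R by rewrite mulf_neq0 ?intr_eq0 ?pnatr_eq0.
rewrite integral_cos_itv // -EFinM; congr (_%:E).
have -> : 2 * q%:~R * pi + c = 2 * q%:~R * 0 + c + 2 * pi * q%:~R by ring.
by rewrite -!cosBpihalf addrAC cos_add_int subrr mul0r !mulr0.
Qed.

(** The two means are compared term by term.  The inner integral V and its
    continuity, as well as that of the integrand, are part of the statement
    because the induction on F needs them for additivity. *)
Lemma grid_sum_torus (N d : nat) F : (0 < N)%N -> (d < 2 * N)%N -> trigpoly d F ->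
  exists V : R -> R, [/\ continuous V,
    forall phi, continuous (fun t => F (t - phi) (2 * phi)),
    forall phi, (\int[mu]_(t in `[(- (pi : R))%R, (pi : R)])
      (F (t - phi) (2 * phi))%:E = (V phi)%:E)%E
  & (\int[mu]_(phi in `[0%R, (pi : R)]) (V phi)%:E
     = (2 * pi ^+ 2 * (grid_sum N F / (3 * N)%:R ^+ 2))%:E)%E].
Proof.
move=> N0 dN.
have M0 : (3 * N)%:R ^+ 2 != 0 :> R by rewrite expf_neq0 // pnatr_eq0 muln_eq0 -lt0n.
have iV (V : R -> R) (a b : R) : continuous V -> mu.-integrable `[a, b] (EFin \o V).
  move=> cV; apply: continuous_compact_integrable; first exact: segment_compact.
  exact: continuous_subspaceT.
elim=> [p q c hp hq hpq|{}F G _ [V [cV cF FV VE]] _ [U [cU cG GU UE]]|c {}F _ [V [cV cF FV VE]]].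
- have [V [cV FV VE]] := torus_integral_cos p q c.
  exists V; split=> //.
    move=> phi.
    have -> : (fun t => cos (p%:~R * (t - phi) + q%:~R * (2 * phi) + c)) =
      (fun t => cos (p%:~R * t + (- p%:~R * phi + q%:~R * (2 * phi) + c))).
      by apply/funext => t; congr cos; ring.
    exact: continuous_cos_aff.
  by rewrite VE grid_sum_cos; [rewrite [X in _ = (_ * X)%:E]mulrAC divff // mul1r | lia..].
- exists (fun t => V t + U t); split.
  + by move=> x; apply: cvgD; [exact: cV | exact: cU].
  + by move=> phi x; apply: cvgD; [exact: cF | exact: cG].
  + move=> phi; under eq_integral do rewrite EFinD.
    rewrite integralD ?FV ?GU //; [exact: (iV _ _ _ (cF phi)) | exact: (iV _ _ _ (cG phi))].
  + under eq_integral do rewrite EFinD.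
    rewrite integralD ?VE ?UE //; [|exact: (iV _ _ _ cV) | exact: (iV _ _ _ cU)].
    rewrite -EFinD; congr (_%:E); rewrite -mulrDr -mulrDl; congr (_ * (_ / _)).
    by rewrite /grid_sum -big_split; apply: eq_bigr => j1 _; rewrite -big_split.
- exists (fun t => c * V t); split.
  + by move=> x; apply: cvgM; [exact: cvg_cst | exact: cV].
  + by move=> phi x; apply: cvgM; [exact: cvg_cst | exact: cF].
  + move=> phi; under eq_integral do rewrite EFinM.
    by rewrite integralZl ?FV //; exact: (iV _ _ _ (cF phi)).
  + under eq_integral do rewrite EFinM.
    rewrite integralZl ?VE //; last exact: (iV _ _ _ cV).
    rewrite -EFinM; congr (_%:E); rewrite mulrCA; congr (_ * _); rewrite mulrA; congr (_ / _).
    by rewrite /grid_sum big_distrr; apply: eq_bigr => j1 _; rewrite big_distrr.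
Qed.

End TrigPoly.

(** * The nodes as a fundamental domain of the grid *)

Section Nodes.
Context {R : realType}.
Implicit Types (f : R * R -> R) (t p : R * R) (N : nat).

Definition torus_x (a b : R) : R := (cos a + cos b + cos (a + b)) / 3.
Definition torus_y (a b : R) : R := (sin a + sin b - sin (a + b)) / 3.
Definition torus_den (a b : R) : R := sin (a + 2 * b) + sin (a - b) - sin (2 * a + b).

Lemma steiner_map_torus t : steiner_map t =
  (torus_x (2 * pi / 3 * (t.1 + 2 * t.2)) (2 * pi / 3 * (t.1 - t.2)),
   torus_y (2 * pi / 3 * (t.1 + 2 * t.2)) (2 * pi / 3 * (t.1 - t.2))).
Proof.
rewrite steiner_mapE /torus_x /torus_y.
set a := 2 * pi / 3 * (t.1 + 2 * t.2); set b := 2 * pi / 3 * (t.1 - t.2).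
have -> : 2 * pi / 3 * (- 2 * t.1 - t.2) = - (a + b) by rewrite /a /b; ring.
by rewrite cosN sinN ![_ / 3]mulrC.
Qed.

Lemma sin_prod_torus t : 4 * sin_prod t =
  torus_den (2 * pi / 3 * (t.1 + 2 * t.2)) (2 * pi / 3 * (t.1 - t.2)).
Proof.
by rewrite sin_prodE /torus_den; congr (sin _ + sin _ - sin _); field.
Qed.

Lemma torus_hypo (phi t : R) :
  [/\ torus_x (t - phi) (2 * phi) = hypo_x phi t,
      torus_y (t - phi) (2 * phi) = hypo_y phi t
    & torus_den (t - phi) (2 * phi) ^+ 2 = 4 * weyl_weight phi t].
Proof.
rewrite /torus_x /torus_y /torus_den /hypo_x /hypo_y /weyl_weight.
have -> : t - phi + 2 * phi = t + phi by ring.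
have -> : t - phi + 2 * (2 * phi) = t + 3 * phi by ring.
have -> : t - phi - 2 * phi = t - 3 * phi by ring.
have -> : 2 * (t - phi) + 2 * phi = 2 * t by ring.
rewrite sin_double (sin_double t); split.
- by rewrite cosB cosD; congr (_ / _); ring.
- by rewrite sinB sinD; congr (_ / _); ring.
- by rewrite sinB sinD; ring.
Qed.

Lemma trigpoly_torus_x : trigpoly 1 torus_x.
Proof.
have h (p q : int) : `|p| <= 1%:Z -> `|q| <= 1%:Z -> `|p - q| <= 1%:Z ->
  trigpoly 1 (fun a b => cos (p%:~R * a + q%:~R * b + 0) : R) by exact: trig_cos.
apply: (eq_trigpoly _ _ _ _ (trig_scale _ 3^-1 _ (trig_add _ _ _ (trig_add _ _ _
  (h 1 0 erefl erefl erefl) (h 0 1 erefl erefl erefl)) (h 1 1 erefl erefl erefl)))).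
by move=> a b; rewrite /torus_x !(mul1r, mul0r, addr0, add0r) mulrC.
Qed.

Lemma trigpoly_torus_y : trigpoly 1 torus_y.
Proof.
have h (p q : int) : `|p| <= 1%:Z -> `|q| <= 1%:Z -> `|p - q| <= 1%:Z ->
  trigpoly 1 (fun a b => sin (p%:~R * a + q%:~R * b) : R) by exact: trigpoly_sin.
apply: (eq_trigpoly _ _ _ _ (trig_scale _ 3^-1 _ (trig_add _ _ _ (trig_add _ _ _
  (h 1 0 erefl erefl erefl) (h 0 1 erefl erefl erefl)) (trig_scale _ (-1) _ (h 1 1 erefl erefl erefl))))).
by move=> a b; rewrite /torus_y !(mul1r, mul0r, addr0, add0r, mulN1r) mulrC.
Qed.

Lemma trigpoly_torus_den : trigpoly 2 torus_den.
Proof.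
have h (p q : int) : `|p| <= 2%:Z -> `|q| <= 2%:Z -> `|p - q| <= 2%:Z ->
  trigpoly 2 (fun a b => sin (p%:~R * a + q%:~R * b) : R) by exact: trigpoly_sin.
apply: (eq_trigpoly _ _ _ _ (trig_add _ _ _ (trig_add _ _ _
  (h 1 2 erefl erefl erefl) (h 1 (-1) erefl erefl erefl)) (trig_scale _ (-1) _ (h 2 1 erefl erefl erefl)))).
by move=> a b; rewrite /torus_den !(mul1r, mulN1r).
Qed.

Lemma evalxyE (f : mpoly 2 R) p : evalxy f p =
  \sum_(m <- msupp f) mcoeff m f * (p.1 ^+ m ord0 * p.2 ^+ m ord_max).
Proof.
rewrite /evalxy mevalE; apply: eq_bigr => m _; congr (_ * _).
by rewrite big_ord_recl big_ord1 !(tnth_nth 0) /=; congr (_ ^+ _ * _ ^+ m _); exact: val_inj.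
Qed.

Lemma trigpoly_evalxy (f : mpoly 2 R) d : (msize f <= d.+1)%N ->
  trigpoly d (fun a b => evalxy f (torus_x a b, torus_y a b)).
Proof.
move=> fd.
apply: (@eq_trigpoly _ _ (fun a b => \sum_(m <- msupp f) mcoeff m f *
   (torus_x a b ^+ m ord0 * torus_y a b ^+ m ord_max))) => [a b|].
  by rewrite evalxyE.
have : {in msupp f, forall m : multinom 2, (m ord0 + m ord_max <= d)%N}.
  move=> m /msize_mdeg_lt; rewrite mdegE big_ord_recl big_ord1.
  have -> : lift ord0 ord0 = ord_max :> 'I_2 by exact: val_inj.
  by move=> h; rewrite -ltnS; exact: leq_trans fd.
elim: (msupp f) => [_|m s ih hs].
  by apply: (eq_trigpoly _ _ _ _ (trigpoly_cst _ 0)) => a b; rewrite big_nil.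
apply: (@eq_trigpoly _ _ (fun a b => mcoeff m f * (torus_x a b ^+ m ord0 * torus_y a b ^+ m ord_max)
   + \sum_(m <- s) mcoeff m f * (torus_x a b ^+ m ord0 * torus_y a b ^+ m ord_max))) => [a b|].
  by rewrite big_cons.
apply: trig_add; last by apply: ih => m' ms; apply: hs; rewrite inE ms orbT.
apply: trig_scale; apply: (@trigpolyW _ (m ord0 * 1 + m ord_max * 1)%N).
  by rewrite !muln1 hs // inE eqxx.
by apply: trigpolyM; apply: trigpolyX; [exact: trigpoly_torus_x | exact: trigpoly_torus_y].
Qed.

Definition weighted f t : R := f (steiner_map t) * sin_prod t ^+ 2.

Let w : R := 2 * pi / 3.

(** Multiplication of z by a primitive third root of unity. *)
Definition rot p : R * R := (cos w * p.1 - sin w * p.2, sin w * p.1 + cos w * p.2).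

Lemma sin_add_int (x : R) (r : int) : sin (x + 2 * pi * r%:~R) = sin x.
Proof. by rewrite -!cosBpihalf addrAC cos_add_int. Qed.

Lemma torus_periodic (a b : R) (p q : int) :
  torus_x (a + 2 * pi * p%:~R) (b + 2 * pi * q%:~R) = torus_x a b /\
  torus_y (a + 2 * pi * p%:~R) (b + 2 * pi * q%:~R) = torus_y a b.
Proof.
have abE : a + 2 * pi * p%:~R + (b + 2 * pi * q%:~R) = a + b + 2 * pi * (p + q)%:~R.
  by rewrite intrD; ring.
by rewrite /torus_x /torus_y abE !cos_add_int !sin_add_int.
Qed.

(** The point z is symmetric in u1, u2, u3. *)
Lemma torus_cycle (a b : R) : torus_x (- (a + b)) a = torus_x a b /\
  torus_y (- (a + b)) a = torus_y a b.
Proof.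
rewrite /torus_x /torus_y; have -> : - (a + b) + a = - b by ring.
by rewrite !cosN !sinN; split; ring.
Qed.

Lemma torus_swap (a b : R) : torus_x (- (a + b)) b = torus_x a b /\
  torus_y (- (a + b)) b = torus_y a b.
Proof.
rewrite /torus_x /torus_y; have -> : - (a + b) + b = - a by ring.
by rewrite !cosN !sinN; split; ring.
Qed.

Lemma rot_torus (a b : R) : rot (torus_x a b, torus_y a b) =
  (torus_x (a + w) (b + w), torus_y (a + w) (b + w)).
Proof.
rewrite /rot /torus_x /torus_y /=.
have -> : a + w + (b + w) = a + b - w + 2 * pi * 1%:~R by rewrite /w; field.
rewrite !cos_add_int !sin_add_int.
by rewrite cosB sinB !cosD !sinD; congr (_, _); field.
Qed.

Lemma steiner_map_shift1 t : steiner_map (t.1 + 1, t.2) = rot (steiner_map t).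
Proof.
rewrite !steiner_map_torus rot_torus /=.
by congr (torus_x _ _, torus_y _ _); rewrite /w; ring.
Qed.

Lemma steiner_map_shift2 t : steiner_map (t.1, t.2 + 1) = rot (rot (steiner_map t)).
Proof.
rewrite !steiner_map_torus !rot_torus /=.
set a := _ * (t.1 + 2 * t.2); set b := _ * (t.1 - t.2).
have -> : 2 * pi / 3 * (t.1 + 2 * (t.2 + 1)) = a + w + w + 2 * pi * 0%:~R.
  by rewrite /a /w; field.
have -> : 2 * pi / 3 * (t.1 - (t.2 + 1)) = b + w + w + 2 * pi * (-1)%:~R.
  by rewrite /b /w; field.
by have [-> ->] := torus_periodic (a + w + w) (b + w + w) 0 (-1).
Qed.

(** The rotation of the triangle of nodes permutes its vertices, which are mapped to
    the three cusps. *)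
Lemma steiner_map_cycle t :
  steiner_map (t.2, 1 - t.1 - t.2) = rot (rot (steiner_map t)).
Proof.
rewrite !steiner_map_torus !rot_torus /=.
set a := _ * (t.1 + 2 * t.2); set b := _ * (t.1 - t.2).
have -> : 2 * pi / 3 * (t.2 - (1 - t.1 - t.2)) = a - w by rewrite /a /w; field.
have -> : 2 * pi / 3 * (t.2 + 2 * (1 - t.1 - t.2)) = - (a - w + (b - w)).
  by rewrite /a /b /w; field.
have [-> ->] := torus_cycle (a - w) (b - w).
have -> : a + w + w = a - w + 2 * pi * 1%:~R by rewrite /w; field.
have -> : b + w + w = b - w + 2 * pi * 1%:~R by rewrite /w; field.
by have [-> ->] := torus_periodic (a - w) (b - w) 1 1.
Qed.

Lemma steiner_map_reflect t : steiner_map (1 - t.2, 1 - t.1) = steiner_map t.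
Proof.
rewrite !steiner_map_torus /=.
set a := _ * (t.1 + 2 * t.2); set b := _ * (t.1 - t.2).
have -> : 2 * pi / 3 * (1 - t.2 - (1 - t.1)) = b + 2 * pi * 0%:~R by rewrite /b; field.
have -> : 2 * pi / 3 * (1 - t.2 + 2 * (1 - t.1)) = - (a + b) + 2 * pi * 1%:~R.
  by rewrite /a /b; field.
have [-> ->] := torus_periodic (- (a + b)) b 1 0.
by have [-> ->] := torus_swap a b.
Qed.

Lemma weighted_shift1 f t : weighted f (t.1 + 1, t.2) = weighted (f \o rot) t.
Proof.
rewrite /weighted steiner_map_shift1 /sin_prod /=; congr (_ * _).
have -> : pi * (t.1 + 1) = pi * t.1 + pi by ring.
have -> : pi * (t.1 + 1 + t.2) = pi * (t.1 + t.2) + pi by ring.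
by rewrite !sinDpi; ring.
Qed.

Lemma weighted_shift2 f t : weighted f (t.1, t.2 + 1) = weighted (f \o rot \o rot) t.
Proof.
rewrite /weighted steiner_map_shift2 /sin_prod /=; congr (_ * _).
have -> : pi * (t.2 + 1) = pi * t.2 + pi by ring.
have -> : pi * (t.1 + (t.2 + 1)) = pi * (t.1 + t.2) + pi by ring.
by rewrite !sinDpi; ring.
Qed.

Lemma weighted_cycle f t :
  weighted f (t.2, 1 - t.1 - t.2) = weighted (f \o rot \o rot) t.
Proof.
rewrite /weighted steiner_map_cycle /sin_prod /=; congr (_ * _).
have -> : pi * (1 - t.1 - t.2) = - (pi * (t.1 + t.2)) + pi by ring.
have -> : pi * (t.2 + (1 - t.1 - t.2)) = - (pi * t.1) + pi by ring.
by rewrite !sinDpi !sinN; ring.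
Qed.

Lemma weighted_reflect f t : weighted f (1 - t.2, 1 - t.1) = weighted f t.
Proof.
rewrite /weighted steiner_map_reflect /sin_prod /=; congr (_ * _).
have -> : pi * (1 - t.2) = - (pi * t.2) + pi by ring.
have -> : pi * (1 - t.1) = - (pi * t.1) + pi by ring.
have -> : pi * (1 - t.2 + (1 - t.1)) = - (pi * (t.1 + t.2)) + pi + pi by ring.
by rewrite !sinDpi !sinN; ring.
Qed.

Lemma sum_triangleE N (u : nat -> nat -> R) :
  \sum_(1 <= i < N) \sum_(1 <= j < N - i) u i j =
  \sum_(1 <= i < N) \sum_(1 <= j < N) if (i + j < N)%N then u i j else 0.
Proof.
apply: eq_big_nat => i /andP[i1 iN].
rewrite (big_nat_widen _ _ N) ?leq_subr // -big_mkcond.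
by apply: eq_bigl => j; lia.
Qed.

Lemma exchange_triangle N (u : nat -> nat -> R) :
  \sum_(1 <= i < N) \sum_(1 <= j < N - i) u i j =
  \sum_(1 <= i < N) \sum_(1 <= j < N - i) u j i.
Proof.
rewrite !sum_triangleE exchange_big_nat.
by apply: eq_bigr => i _; apply: eq_bigr => j _; rewrite addnC.
Qed.

Definition triangle_sum N f : R :=
  \sum_(1 <= i < N) \sum_(1 <= j < N - i) weighted f (i%:R / N%:R, j%:R / N%:R).

(** The rotation of the triangle permutes the nodes. *)
Lemma triangle_sum_rot2 N f : (0 < N)%N ->
  triangle_sum N (f \o rot \o rot) = triangle_sum N f.
Proof.
move=> N0; have NR : N%:R != 0 :> R by rewrite pnatr_eq0 -lt0n.
rewrite /triangle_sum exchange_triangle.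
apply: eq_big_nat => i /andP[i1 iN]; rewrite [LHS]big_nat_rev.
apply: eq_big_nat => j /andP[j1 jN].
rewrite -(weighted_cycle f (_, _)) /=; congr (weighted f (_, _)).
apply: (mulIf NR); rewrite !mulrBl mul1r !divfK //.
by rewrite -!natrB; [congr (_%:R) | |]; lia.
Qed.

(** The antidiagonal cuts the square into two triangles, exchanged by the
    reflection. *)
Lemma sum_square N (u : nat -> nat -> R) : (0 < N)%N ->
  (forall i, u 0%N i = 0) -> (forall i, u i 0%N = 0) ->
  (forall i j, (i + j = N)%N -> u i j = 0) ->
  (forall i j, (0 < i < N)%N -> (0 < j < N)%N -> u (N - j)%N (N - i)%N = u i j) ->
  \sum_(0 <= i < N) \sum_(0 <= j < N) u i j =
  2 * \sum_(1 <= i < N) \sum_(1 <= j < N - i) u i j.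
Proof.
move=> N0 u0 u1 uN ur.
have -> : \sum_(0 <= i < N) \sum_(0 <= j < N) u i j =
    \sum_(1 <= i < N) \sum_(1 <= j < N) u i j.
  rewrite big_ltn // big1 ?add0r; last by move=> j _; exact: u0.
  by apply: eq_bigr => i _; rewrite big_ltn // u1 add0r.
have -> : \sum_(1 <= i < N) \sum_(1 <= j < N) u i j =
    \sum_(1 <= i < N) \sum_(1 <= j < N) (if (i + j < N)%N then u i j else 0)
    + \sum_(1 <= i < N) \sum_(1 <= j < N) (if (N < i + j)%N then u i j else 0).
  rewrite -big_split; apply: eq_bigr => i _; rewrite -big_split; apply: eq_bigr => j _ /=.
  by case: ltngtP => ij; rewrite ?addr0 ?add0r // uN.
rewrite -!sum_triangleE mulrDl mul1r; congr (_ + _).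
rewrite sum_triangleE exchange_big_nat [LHS]big_nat_rev.
apply: eq_big_nat => i i0; rewrite [LHS]big_nat_rev.
apply: eq_big_nat => j j0.
have -> : (1 + N - i.+1 = N - i)%N by lia.
have -> : (1 + N - j.+1 = N - j)%N by lia.
rewrite ur //; case: ifP; case: ifP => //; lia.
Qed.

Lemma sum_nat3 N (F : nat -> R) : \sum_(0 <= i < 3 * N) F i =
  \sum_(0 <= i < N) (F i + F (N + i)%N + F (2 * N + i)%N).
Proof.
rewrite (big_cat_nat _ (n := N)) //=; last by lia.
rewrite (big_cat_nat _ (m := N) (n := (2 * N)%N)) //=; try lia.
rewrite !big_split /= -addrA; congr (_ + (_ + _)).
  by rewrite -{1}[N]add0n big_addn; have -> : (2 * N - N = N)%N by [lia];
     apply: eq_bigr => i _; rewrite addnC.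
rewrite -{1}[(2 * N)%N]add0n big_addn; have -> : (3 * N - 2 * N = N)%N by lia.
by apply: eq_bigr => i _; rewrite addnC.
Qed.

Lemma weighted_square N f : (0 < N)%N ->
  \sum_(0 <= i < N) \sum_(0 <= j < N) weighted f (i%:R / N%:R, j%:R / N%:R) =
  2 * triangle_sum N f.
Proof.
move=> N0; have NR : N%:R != 0 :> R by rewrite pnatr_eq0 -lt0n.
apply: (sum_square N (fun i j => weighted f (i%:R / N%:R, j%:R / N%:R))) => //.
- by move=> i; rewrite /weighted /sin_prod /= mul0r mulr0 sin0 !mul0r expr0n mulr0.
- by move=> i; rewrite /weighted /sin_prod /= mul0r mulr0 sin0 mulr0 mul0r expr0n mulr0.
- move=> i j ij; rewrite /weighted /sin_prod /= -mulrDl -natrD ij divff // mulr1 sinpi.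
  by rewrite mulr0 expr0n mulr0.
- move=> i j /andP[_ iN] /andP[_ jN]; rewrite -(weighted_reflect f (i%:R / N%:R, j%:R / N%:R)) /=.
  by rewrite (natrB _ (ltnW iN)) (natrB _ (ltnW jN)) !mulrBl divff.
Qed.

(** The large square consists of 9 unit squares, each of which consists of two
    triangles; 16 comes from torus_den = 4 sin_prod. *)
Lemma grid_sum_triangle N (f : R * R -> R) : (0 < N)%N ->
  grid_sum N (fun a b => f (torus_x a b, torus_y a b) * torus_den a b ^+ 2) =
  16 * 18 * triangle_sum N f.
Proof.
move=> N0; have NR : N%:R != 0 :> R by rewrite pnatr_eq0 -lt0n.
pose sq g : R := \sum_(0 <= i < N) \sum_(0 <= j < N) weighted g (i%:R / N%:R, j%:R / N%:R).
transitivity (16 * \sum_(0 <= i < 3 * N) \sum_(0 <= j < 3 * N)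
    weighted f (i%:R / N%:R, j%:R / N%:R)).
  rewrite /grid_sum big_distrr; apply: eq_bigr => i _; rewrite big_distrr.
  apply: eq_bigr => j _ /=.
  rewrite /weighted steiner_map_torus [RHS]mulrCA /=.
  have -> : 16 * sin_prod (i%:R / N%:R, j%:R / N%:R) ^+ 2 =
    (4 * sin_prod (i%:R / N%:R, j%:R / N%:R)) ^+ 2 :> R by ring.
  rewrite sin_prod_torus /=.
  have -> : 2 * pi / (3 * N)%:R * (i%:R + 2 * j%:R) =
    2 * pi / 3 * (i%:R / N%:R + 2 * (j%:R / N%:R)) :> R by rewrite natrM; field.
  have -> : 2 * pi / (3 * N)%:R * (i%:R - j%:R) =
    2 * pi / 3 * (i%:R / N%:R - j%:R / N%:R) :> R by rewrite natrM; field.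
  by [].
rewrite -mulrA; congr (_ * _).
have sh1 (i : nat) y g : weighted g ((N + i)%:R / N%:R, y) = weighted (g \o rot) (i%:R / N%:R, y).
  by rewrite -(weighted_shift1 g (_, _)) /= natrD mulrDl divff // addrC.
have sh2 x (i : nat) g : weighted g (x, (N + i)%:R / N%:R) = weighted (g \o rot \o rot) (x, i%:R / N%:R).
  by rewrite -(weighted_shift2 g (_, _)) /= natrD mulrDl divff // addrC.
have rows g : \sum_(0 <= i < N) \sum_(0 <= j < 3 * N) weighted g (i%:R / N%:R, j%:R / N%:R) =
    6 * triangle_sum N g.
  transitivity (sq g + sq (g \o rot \o rot) + sq (g \o rot \o rot \o rot \o rot)).
    rewrite /sq -!big_split; apply: eq_bigr => i _; rewrite sum_nat3 -!big_split.
    apply: eq_bigr => j _ /=; rewrite mul2n -addnn -addnA !sh2 //.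
  rewrite /sq !weighted_square // !triangle_sum_rot2 //; ring.
rewrite sum_nat3 !big_split /=.
have -> : \sum_(0 <= i < N) \sum_(0 <= j < 3 * N) weighted f ((N + i)%:R / N%:R, j%:R / N%:R) =
    6 * triangle_sum N (f \o rot).
  by rewrite -rows; apply: eq_bigr => i _; apply: eq_bigr => j _; rewrite sh1.
have -> : \sum_(0 <= i < N) \sum_(0 <= j < 3 * N) weighted f ((2 * N + i)%:R / N%:R, j%:R / N%:R) =
    6 * triangle_sum N (f \o rot \o rot).
  by rewrite -rows; apply: eq_bigr => i _; apply: eq_bigr => j _; rewrite mul2n -addnn -addnA !sh1.
(* rot has order 3 on the image of the torus, so that rot = rot ^ 4 there *)
have -> : triangle_sum N (f \o rot) = triangle_sum N f.
  rewrite -(triangle_sum_rot2 N (f \o rot)) // /triangle_sum.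
  apply: eq_bigr => i _; apply: eq_bigr => j _; rewrite /weighted; congr (_ * _) => /=.
  rewrite !steiner_map_torus !rot_torus; congr f.
  set a := _ * (_ + _); set b := _ * (_ - _).
  have -> : a + w + w + w = a + 2 * pi * 1%:~R by rewrite /w; field.
  have -> : b + w + w + w = b + 2 * pi * 1%:~R by rewrite /w; field.
  by have [-> ->] := torus_periodic a b 1 1.
rewrite rows triangle_sum_rot2 //; ring.
Qed.

End Nodes.

(** * Exactness on polynomials *)

Section Exactness.
Context {R : realType}.
Notation mu := (@lebesgue_measure R).

Lemma continuous_evalxy (f : mpoly 2 R) : continuous (evalxy f).
Proof.
have -> : evalxy f = fun p => \sum_(m <- msupp f) mcoeff m f * (p.1 ^+ m ord0 * p.2 ^+ m ord_max).
  by apply/funext => p; rewrite evalxyE.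
elim: (msupp f) => [|m s ih].
  by under eq_fun do rewrite big_nil; move=> p; exact: cvg_cst.
under eq_fun do rewrite big_cons; move=> p; apply: cvgD; last exact: ih.
apply: cvgM; first exact: cvg_cst.
have cX (u : R * R -> R) n : {for p, continuous u} -> {for p, continuous (fun q => u q ^+ n)}.
  by move=> cu; apply: (@continuous_comp _ _ _ u (fun x : R => x ^+ n)) => //; exact: exprn_continuous.
by apply: cvgM; apply: cX; [exact: cvg_fst | exact: cvg_snd].
Qed.

Lemma measurable_evalxy (f : mpoly 2 R) : measurable_fun setT (evalxy f).
Proof.
have -> : evalxy f = fun p => \sum_(m <- msupp f) mcoeff m f * (p.1 ^+ m ord0 * p.2 ^+ m ord_max).
  by apply/funext => p; rewrite evalxyE.
apply: measurable_sum => m; apply: measurable_funM => //.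
by apply: measurable_funM; apply: measurable_funX; [exact: measurable_fst | exact: measurable_snd].
Qed.

Lemma bounded_evalxy (f : mpoly 2 R) :
  exists K, forall x y, `|x| <= 2 -> `|y| <= 2 -> `|evalxy f (x, y)| <= K.
Proof.
exists (\sum_(m <- msupp f) `|mcoeff m f| * (2 ^+ m ord0 * 2 ^+ m ord_max)) => x y x2 y2.
rewrite evalxyE; apply: (le_trans (ler_norm_sum _ _ _)); apply: ler_sum => m _.
rewrite !normrM !normrX ler_wpM2l //.
by apply: ler_pM; rewrite ?exprn_ge0 //; apply: lerXn2r; rewrite ?nnegrE.
Qed.

Lemma integral_hypocycloid_evalxy (N d : nat) (f : mpoly 2 R) :
  (msize f <= d.+1)%N -> (d + 4 < 2 * N)%N ->
  (\int[lebesgue2]_(p in hypocycloid) (evalxy f p * w_half p)%:E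
   = (256 * pi ^+ 4 / (729 * N%:R ^+ 2) * triangle_sum N (evalxy f))%:E)%E.
Proof.
move=> fd dN; have N0 : (0 < N)%N by lia.
have NR : N%:R != 0 :> R by rewrite pnatr_eq0 -lt0n.
have s3 : Num.sqrt 3 ^+ 2 = 3 :> R by rewrite sqr_sqrtr.
have s30 : Num.sqrt 3 != 0 :> R by rewrite sqrtr_eq0 -ltNge.
have [K fK] := bounded_evalxy f.
pose C : R := 16 / (27 * Num.sqrt 3).
pose T := triangle_sum N (evalxy f).
have hF : trigpoly (d + 2 * 2)
    (fun a b => evalxy f (torus_x a b, torus_y a b) * torus_den a b ^+ 2).
  by apply: trigpolyM; [exact: trigpoly_evalxy | apply: trigpolyX; exact: trigpoly_torus_den].
have [|V [cV cF FV VE]] := grid_sum_torus N _ _ N0 _ hF; first by lia.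
rewrite grid_sum_triangle // in VE.
have iV (U : R -> R) (a b : R) : continuous U -> mu.-integrable `[a, b] (EFin \o U).
  move=> cU; apply: continuous_compact_integrable; first exact: segment_compact.
  exact: continuous_subspaceT.
have IE := integral_hypocycloid_torus _ (@continuous_evalxy f) (@measurable_evalxy f) K fK.
have inner (phi : R) : (\int[mu]_(t in `[(- (pi : R))%R, (pi : R)])
    (16 / (27 * Num.sqrt 3) * (evalxy f (hypo_x phi t, hypo_y phi t) * weyl_weight phi t))%:E
    = (C / 4 * V phi)%:E)%E.
  rewrite [RHS]EFinM -FV -integralZl //; last exact: (iV _ _ _ (cF phi)).
  apply: eq_integral => t _; rewrite -EFinM; congr (_%:E).
  have [-> -> ->] := torus_hypo phi t; by rewrite -/C; field.
have IE2 : (6%:E * \int[lebesgue2]_p (evalxy f p * Num.sqrt (steiner_poly p))%:E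
    = (C / 4 * (2 * pi ^+ 2 * (16 * 18 * T / (3 * N)%:R ^+ 2)))%:E)%E.
  rewrite [RHS]EFinM -VE -[RHS]integralZl //; last exact: (iV _ _ _ cV).
  transitivity (\int[mu]_(phi in `]0%R, (pi : R)[) (C / 4 * V phi)%:E)%E.
    by rewrite IE; apply: eq_integral => phi _; exact: inner.
  under [RHS]eq_integral do rewrite -EFinM.
  apply/esym/integral_itv_bndoo/measurable_EFinP/measurable_funM => //.
  exact: measurable_funTS (continuous_measurable_fun cV).
have -> : (\int[lebesgue2]_(p in hypocycloid) (evalxy f p * w_half p)%:E
   = (2 * pi ^+ 2 / (3 * Num.sqrt 3))%:E
     * \int[lebesgue2]_p (evalxy f p * Num.sqrt (steiner_poly p))%:E)%E.
  rewrite -integralZl //; last first.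
    exact: (integrable_sqrt_steiner _ (@measurable_evalxy f) K fK).
  rewrite [LHS]integral_mkcond; apply: eq_integral => p _.
  rewrite patchE -EFinM; case: ifPn => [_|/negP hp].
    by congr (_%:E); rewrite /w_half; ring.
  have P0 : steiner_poly p <= 0.
    by rewrite leNgt; apply/negP => p0; apply: hp; rewrite inE; exact: ltW.
  by rewrite (ler0_sqrtr P0) !mulr0.
have -> : (\int[lebesgue2]_p (evalxy f p * Num.sqrt (steiner_poly p))%:E
   = (6^-1)%:E * (6%:E * \int[lebesgue2]_p (evalxy f p * Num.sqrt (steiner_poly p))%:E))%E.
  by rewrite muleA -EFinM mulVf // mul1e.
rewrite IE2 -!EFinM; congr (_%:E); rewrite /C -/T natrM.
have -> : 2 * pi ^+ 2 / (3 * Num.sqrt 3) * (6^-1 * (16 / (27 * Num.sqrt 3) / 4 *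
   (2 * pi ^+ 2 * (16 * 18 * T / (3 * N%:R) ^+ 2)))) =
   (768 * pi ^+ 4 / 729) * T / N%:R ^+ 2 / Num.sqrt 3 ^+ 2.
  by field; rewrite NR s30.
by rewrite s3; field.
Qed.

End Exactness.

(** * The Gauss rule *)

Section Rule.
Context {R : realType}.

Definition node_index (n : nat) : seq (nat * nat) :=
  [seq (j1, j2) | j1 <- index_iota 1 n.+2, j2 <- index_iota 1 (n.+2 - j1)].

Lemma mem_node_index n (j : nat * nat) :
  (j \in node_index n) = [&& 0 < j.1, 0 < j.2 & j.1 + j.2 < n.+2]%N.
Proof.
apply/allpairsPdep/idP => [[j1 [j2 [+ + ->]]]|]; rewrite ?mem_index_iota /=; first lia.
by case: j => j1 j2 /= jn; exists j1, j2; rewrite !mem_index_iota; split => //; lia.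
Qed.

Lemma uniq_node_index n : uniq (node_index n).
Proof.
apply: allpairs_uniq_dep => [||[? ?] [? ?] _ _ [-> ->] //]; first exact: iota_uniq.
by move=> j1 _; exact: iota_uniq.
Qed.

Lemma gauss_ruleE n : gauss_rule n =
  [seq (c_half^-1 * mu n j.1 j.2, node n j.1 j.2) | j <- node_index n] :> seq (R * (R * R)).
Proof. by rewrite /gauss_rule /node_index map_allpairs. Qed.

Lemma sum_gauss_rule n (F : nat -> nat -> R) :
  \sum_(j <- node_index n) F j.1 j.2 =
  \sum_(1 <= j1 < n.+2) \sum_(1 <= j2 < n.+2 - j1) F j1 j2.
Proof. by rewrite big_allpairs_dep. Qed.

Lemma expiD (a b : R) : expi (a + b) = expi a * expi b :> R[i].
Proof.
rewrite /expi cosD sinD; apply/eqP; rewrite eq_complex /=.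
by apply/andP; split; apply/eqP; ring.
Qed.

Lemma expi_inj_frac (M : nat) (p q : int) : (0 < M)%N ->
  expi (2 * pi * p%:~R / M%:R : R) = expi (2 * pi * q%:~R / M%:R) ->
  exists m : int, p - q = m * M%:Z.
Proof.
move=> M0 [ec es]; have MR : M%:R != 0 :> R by rewrite pnatr_eq0 -lt0n.
have s0 : sin (pi * (p - q)%:~R / M%:R : R) = 0.
  set x := pi * _ / _; apply/eqP; rewrite -sqrf_eq0.
  have : cos (x + x) = 1.
    have -> : x + x = 2 * pi * p%:~R / M%:R - 2 * pi * q%:~R / M%:R.
      by rewrite /x intrD intrN; field.
    by rewrite cosB ec es -!expr2 cos2Dsin2.
  rewrite cosD -!expr2 => h; have := sqr_sinE x => hx.
  by apply/eqP; lra.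
have [/dvdzP[m ->]|h] := boolP (M%:Z %| (p - q : int))%Z; first by exists m.
by have := @sin_pi_frac_neq0 R _ _ M0 h; rewrite s0 eqxx.
Qed.

(** As u1 u2 u3 = 1, the point z and its conjugate determine all the elementary
    symmetric functions of the u_k, hence the polynomial of which they are the
    roots. *)
Lemma expi_torus (a b a' b' : R) :
  torus_x a b = torus_x a' b' -> torus_y a b = torus_y a' b' ->
  forall c, [\/ c = a, c = b | c = - (a + b)] ->
  [\/ expi c = expi a', expi c = expi b' | expi c = expi (- (a' + b'))].
Proof.
move=> hx hy.
have e0 : expi (0 : R) = 1 by rewrite /expi cos0 sin0.
have prod1 x y : expi x * expi y * expi (- (x + y)) = 1 :> R[i].
  by rewrite -!expiD addrN e0.
have e1 : expi a + expi b + expi (- (a + b)) = expi a' + expi b' + expi (- (a' + b')).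
  apply/eqP; rewrite eq_complex /= !cosN !sinN.
  have h x y : x / 3 = y / 3 -> x = y :> R by lra.
  by rewrite (h _ _ hx) (h _ _ hy) !eqxx.
have e2 : expi (- a) + expi (- b) + expi (a + b) = expi (- a') + expi (- b') + expi (a' + b').
  apply/eqP; rewrite eq_complex /= !cosN !sinN.
  have h x y : x / 3 = y / 3 -> x = y :> R by lra.
  by have := h _ _ hx; have := h _ _ hy => h1 h2; apply/andP; split; apply/eqP; lra.
have e2E x y : expi (- x) + expi (- y) + expi (x + y) =
    expi x * expi y + expi (- (x + y)) * (expi x + expi y) :> R[i].
  have -> : expi (- x) = expi (- (x + y)) * expi y :> R[i] by rewrite -expiD; congr expi; ring.
  have -> : expi (- y) = expi (- (x + y)) * expi x :> R[i] by rewrite -expiD; congr expi; ring.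
  by rewrite (expiD x y); ring.
rewrite !e2E in e2.
move=> c cE.
have : (expi c - expi a) * (expi c - expi b) * (expi c - expi (- (a + b))) = 0.
  by case: cE => ->; rewrite subrr ?mulr0 ?mul0r.
have vieta (u v w z : R[i]) : (u - v) * (u - w) * (u - z) =
   u ^+ 3 - (v + w + z) * u ^+ 2 + (v * w + z * (v + w)) * u - v * w * z by ring.
rewrite vieta e1 e2 prod1 -(prod1 a' b') -vieta => /eqP.
rewrite !mulf_eq0 !subr_eq0 => /orP[/orP[]|] /eqP ->;
  [exact: Or31 | exact: Or32 | exact: Or33].
Qed.

Lemma node_torus n j1 j2 : let M := (3 * n.+2)%N in
  node n j1 j2 =
  (torus_x (2 * pi * (j1%:Z + 2 * j2%:Z)%:~R / M%:R) (2 * pi * (j1%:Z - j2%:Z)%:~R / M%:R),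
   torus_y (2 * pi * (j1%:Z + 2 * j2%:Z)%:~R / M%:R) (2 * pi * (j1%:Z - j2%:Z)%:~R / M%:R))
  :> R * R.
Proof.
rewrite /node steiner_map_torus natrM.
have -> : (j1%:Z + 2 * j2%:Z)%:~R = j1%:R + 2 * j2%:R :> R by rewrite intrD intrM.
have -> : (j1%:Z - j2%:Z)%:~R = j1%:R - j2%:R :> R by rewrite intrB.
have NR : n.+2%:R != 0 :> R by rewrite pnatr_eq0.
by congr (torus_x _ _, torus_y _ _); rewrite /=; field.
Qed.

(** Two equal nodes have the same u_k up to order, where u_k is the root of unity of
    order 3 N and exponent j1 + 2 j2, j1 - j2 or - 2 j1 - j2.  The
    inequalities that define the triangle exclude all permutations but the
    identity. *)
Lemma node_inj n :
  {in node_index n &, injective (fun j : nat * nat => node n j.1 j.2 : R * R)}.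
Proof.
move=> [i1 i2] [j1 j2]; rewrite !mem_node_index /= => iN jN.
rewrite !node_torus.
have [M ME] : {M | M = (3 * n.+2)%N} by exists (3 * n.+2)%N.
rewrite -!ME => -[hx hy].
have M0 : (0 < M)%N by lia.
have sumE (p q : int) : - (2 * pi * p%:~R / M%:R + 2 * pi * q%:~R / M%:R) =
    2 * pi * (- p - q)%:~R / M%:R :> R.
  by rewrite intrD !intrN; field; rewrite pnatr_eq0 -lt0n.
have key (p q : int) :
    expi (2 * pi * p%:~R / M%:R : R) = expi (2 * pi * q%:~R / M%:R) ->
    `|p - q| < 2 * M%:Z -> p - q = 0 \/ p - q = M%:Z \/ p - q = - M%:Z.
  move=> /(expi_inj_frac _ _ _ M0)[m mE] pq.
  have m1 : `|m| < 2 by move: pq; rewrite mE normrM [X in _ * X]ger0_norm // ltr_pM2r.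
  have : m = 0 \/ m = 1 \/ m = -1 by lia.
  by rewrite mE; case=> [->|[->|->]]; lia.
have tri := expi_torus _ _ _ _ hx hy.
have {tri} [h1 h3] := (tri _ (Or31 _ _ erefl), tri _ (Or33 _ _ erefl)).
rewrite !sumE in h1 h3; move: h1 h3 => {hx hy sumE}.
move=> [] /key h1 [] /key h3; have {}h1 := h1 ltac:(lia); have {}h3 := h3 ltac:(lia);
  (have e1 : i1 = j1 by lia); (have e2 : i2 = j2 by lia); by rewrite e1 e2.
Qed.

(** The indices of the nodes start at 1, those of the monomials at 0. *)
Definition monom (j : nat * nat) : multinom 2 := Multinom [tuple j.1.-1; j.2.-1].

Lemma mdeg_monom j : mdeg (monom j) = (j.1.-1 + j.2.-1)%N.
Proof. by rewrite mdegE big_ord_recl big_ord1. Qed.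

Lemma mem_monoms n (m : multinom 2) :
  (m \in [seq monom j | j <- node_index n]) = (mdeg m < n)%N.
Proof.
apply/mapP/idP => [[j + ->]|mn].
  by rewrite mem_node_index mdeg_monom; lia.
exists ((m ord0).+1, (m ord_max).+1).
  move: mn; rewrite mem_node_index mdegE big_ord_recl big_ord1 /=.
  have -> : lift ord0 ord0 = ord_max :> 'I_2 by exact: val_inj.
  by lia.
apply/mnmP => i; rewrite /monom multinomE (tnth_nth 0%N) /=.
by case: i => [[|[|]]] //= h; congr (m _); exact: val_inj.
Qed.

Lemma uniq_monoms n : uniq [seq monom j | j <- node_index n].
Proof.
rewrite map_inj_in_uniq ?uniq_node_index // => -[i1 i2] [j1 j2].
rewrite !mem_node_index /= => hi hj [] e1 e2.
by congr (_, _); lia.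
Qed.

Lemma has_dim_Pi2 n : (1 <= n)%N -> has_dim (@Pi2 R n.-1) (size (node_index n)).
Proof.
move=> n1; set s := [seq monom j | j <- node_index n].
have ss : size s = size (node_index n) by rewrite size_map.
rewrite -ss.
pose b (i : 'I_(size s)) : mpoly 2 R := mpolyX R (nth mnm0 s i).
have bs (i : 'I_(size s)) : nth mnm0 s i \in s by rewrite mem_nth.
have coefb (a : 'I_(size s) -> R) m :
    mcoeff m (\sum_i a i *: b i) = \sum_i a i * (nth mnm0 s i == m)%:R.
  by rewrite raddf_sum; apply: eq_bigr => i _; rewrite /= mcoeffZ mcoeffX.
exists b; split.
- by move=> i; rewrite /Pi2 /= msizeX prednK // -mem_monoms.
- move=> a a0 i; have := coefb a (nth mnm0 s i); rewrite a0 mcoeff0.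
  rewrite (bigD1 i) //= eqxx mulr1 big1 ?addr0 // => j ji.
  by rewrite nth_uniq ?uniq_monoms // (inj_eq val_inj) (negbTE ji) mulr0.
- move=> f; rewrite /Pi2 /= prednK // => fn.
  exists (fun i => mcoeff (nth mnm0 s i) f).
  apply/mpolyP => m; rewrite coefb.
  have [ms|ms] := boolP (m \in s).
    have im : (index m s < size s)%N by rewrite index_mem.
    rewrite (bigD1 (Ordinal im)) //= nth_index // eqxx mulr1 big1 ?addr0 // => j ji.
    case: eqVneq => jm; last by rewrite mulr0.
    case/eqP: ji; apply: val_inj => /=; rewrite -jm index_uniq ?uniq_monoms //.
  rewrite big1 => [|i _]; last first.
    by case: eqVneq => im; [case/negP: ms; rewrite -im bs | rewrite mulr0].
  by apply/eqP; rewrite mcoeff_eq0; apply: contra ms => /msize_mdeg_lt mf;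
    rewrite mem_monoms (leq_trans mf).
Qed.

End Rule.

Lemma mu_weighted (R : realType) (n j1 j2 : nat) (f : mpoly 2 R) :
  mu n j1 j2 * evalxy f (node n j1 j2) =
  32 / (9 * n.+2%:R ^+ 2) * weighted (evalxy f) (j1%:R / n.+2%:R, j2%:R / n.+2%:R).
Proof. by rewrite /mu /weighted /node /sin_prod /= -mulrDl natrD !mulrA; ring. Qed.

Lemma sum_mu_triangle (R : realType) (n : nat) (f : mpoly 2 R) :
  \sum_(1 <= j1 < n.+2) \sum_(1 <= j2 < n.+2 - j1) mu n j1 j2 * evalxy f (node n j1 j2)
  = 32 / (9 * n.+2%:R ^+ 2) * triangle_sum n.+2 (evalxy f).
Proof.
rewrite /triangle_sum big_distrr; apply: eq_bigr => j1 _; rewrite big_distrr.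
by apply: eq_bigr => j2 _; exact: mu_weighted.
Qed.

Theorem theorem5p3 (R : realType) (n : nat) (hn : (1 <= n)%N) :
  gaussian_cubature (@hypocycloid R) w_half n (gauss_rule n) /\
  (forall f : mpoly 2 R, Pi2 (2 * n).-1 f ->
    (c_half%:E * \int[lebesgue2]_(p in hypocycloid) (evalxy f p * w_half p)%:E)%E
    = (\sum_(1 <= j1 < n.+2) \sum_(1 <= j2 < n.+2 - j1)
         mu n j1 j2 * evalxy f (node n j1 j2))%:E).
Proof.
have p0 : pi != 0 :> R by rewrite gt_eqF // pi_gt0.
have c0 : c_half != 0 :> R by rewrite /c_half !mulf_neq0 ?invr_eq0 ?mulf_neq0 ?expf_neq0 ?pnatr_eq0.
have exact (f : mpoly 2 R) : Pi2 (2 * n).-1 f ->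
    (\int[lebesgue2]_(p in hypocycloid) (evalxy f p * w_half p)%:E
     = (c_half^-1 * (\sum_(1 <= j1 < n.+2) \sum_(1 <= j2 < n.+2 - j1)
         mu n j1 j2 * evalxy f (node n j1 j2)))%:E)%E.
  move=> fn; rewrite (integral_hypocycloid_evalxy n.+2 _ _ fn); last by lia.
  rewrite sum_mu_triangle /c_half; congr (_%:E).
  have NR : n.+2%:R != 0 :> R by rewrite pnatr_eq0.
  move: (triangle_sum _ _) (n.+2%:R) NR (pi : R) p0 => T N NR q q0.
  by field; rewrite NR q0.
split; last by move=> f /exact ->; rewrite -EFinM mulrA divff // mul1r.
split.
- rewrite gauss_ruleE -map_comp map_inj_in_uniq ?uniq_node_index //.
  exact: node_inj.
- by rewrite gauss_ruleE size_map; exact: has_dim_Pi2.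
- move=> f /exact ->; congr (_%:E).
  rewrite gauss_ruleE big_map -(sum_gauss_rule n (fun j1 j2 => mu n j1 j2 * evalxy f (node n j1 j2))).
  by rewrite big_distrr; apply: eq_bigr => j _; rewrite /= mulrA.
Qed.
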